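(* Let $h$ be analytic in $\mathbb{D}=\{|z|<1\}$ with $h(0)=0$, $h'(0)=1$, and let $u(z)=h(z)+\frac{1}{2}(1-|z|^2)\,zh'(z)$ for $z\in\mathbb{D}$. Then: (1) if $h$ is convex (univalent) in $\mathbb{D}$, then $u$ is sense-preserving in $\mathbb{D}$; (2) if $h$ is a convex function of order $\alpha$ for some $\alpha$ with $-1/2\le\alpha<0$, then $u$ is sense-preserving in $\mathbb{D}$; in particular, $u$ is sense-preserving in $|z|<1$ if $h$ is a convex function of order $-1/2$; (3) if $h$ is univalent in $\mathbb{D}$, then $u$ is sense-preserving in the disk $|z|<\sqrt{7}-2$.
   Context: A function $u$ of class $C^1$ is sense-preserving in a domain if its Jacobian $J_u=|u_z|^2-|u_{\overline z}|^2$ is positive there. For $\alpha\in[-1/2,1)$, a locally univalent analytic function $h(z)=z+a_2z^2+\cdots$ in $\mathbb{D}$ is convex of order $\alpha$ if $\operatorname{Re}\big(1+zh''(z)/h'(z)\big)>\alpha$ for all $z\in\mathbb{D}$; convex of order $0$ is the usual notion of a convex univalent function. *)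

(* Defs.v *)
From Stdlib Require Import Reals.
From Coquelicot Require Import Coquelicot.
Open Scope R_scope.

Definition disk (r : R) (z : C) : Prop := Cmod z < r.

Definition cderiv (f : C -> C) (z : C) (l : C) : Prop :=
  @is_derive C_AbsRing C_NormedModule f z l.

Definition analytic_in_D (f : C -> C) : Prop :=
  exists a : nat -> C, forall z : C, disk 1 z ->
    @is_pseries C_AbsRing C_NormedModule a z (f z).

Definition univalent_in_D (f : C -> C) : Prop :=
  forall z w : C, disk 1 z -> disk 1 w -> f z = f w -> z = w.

(* h locally univalent and convex of order alpha in D, where h1 = h', h2 = h'' on D:
   h'(z) <> 0 and Re (1 + z h''(z)/h'(z)) > alpha for all z in D *)
Definition convex_of_order (alpha : R) (h1 h2 : C -> C) : Prop :=
  forall z : C, disk 1 z ->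
    h1 z <> 0%C /\ Re (1 + z * h2 z / h1 z)%C > alpha.

Definition partial_x (u : C -> C) (z ux : C) : Prop :=
  @is_derive R_AbsRing C_R_NormedModule (fun t : R => u (z + RtoC t)%C) 0 ux.
Definition partial_y (u : C -> C) (z uy : C) : Prop :=
  @is_derive R_AbsRing C_R_NormedModule (fun t : R => u (z + RtoC t * Ci)%C) 0 uy.

(* Wirtinger derivatives u_z = (u_x - i u_y)/2, u_zbar = (u_x + i u_y)/2,
   Jacobian J_u = |u_z|^2 - |u_zbar|^2 *)
Definition jacobian (ux uy : C) : R :=
  (Cmod ((ux - Ci * uy) / 2)%C) ^ 2 - (Cmod ((ux + Ci * uy) / 2)%C) ^ 2.

Definition sense_preserving (Omega : C -> Prop) (u : C -> C) : Prop :=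
  exists ux uy : C -> C,
    (forall z, Omega z ->
       partial_x u z (ux z) /\ partial_y u z (uy z) /\
       @continuous C_UniformSpace C_UniformSpace u z /\
       @continuous C_UniformSpace C_UniformSpace ux z /\
       @continuous C_UniformSpace C_UniformSpace uy z /\
       jacobian (ux z) (uy z) > 0).

(* Main.v *)
(* [u_z = h' (1 - r^2 / 2 + (1 - r^2) / 2 (1 + z h'' / h'))] and
   [|u_zbar| = r^2 |h'| / 2] with [r = |z|], so the Jacobian is positive as soon as
   [Re (1 + z h'' / h') > -2]. For univalent [h] this follows for [r < sqrt 7 - 2]
   from [|(1 - r^2) h'' - 2 conj z h'| <= 4 |h'|], that is, from Bieberbach's
   inequality [|a_2| <= 2] applied to the Koebe transforms of [h].

   Bieberbach's inequality is obtained without the area theorem. For a univalent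
   [f : D -> D] with [f 0 = 0] put [A f = |f''(0) / (2 f'(0))|]. If [f] omits [c], Koebe's
   square root transformation gives a univalent [g : D -> D] with
   [|f'(0)| = l |g'(0)|], [l = 2 sqrt |c| / (1 + |c|)], and
   [A f <= A g + (1 + 1 / l) (|g'(0)| - |f'(0)|)]. Iterating with [|c| = rho] fixed close
   to 1 until the circle [|w| = rho] is covered leads to a map with derivative at least
   [rho], whose [A] is small, while the increments telescope; hence [A f <= 2]. *)

Require Import Defs.
From Stdlib Require Import Reals Ranalysis5 Lra Lia Classical ClassicalEpsilon.
From Coquelicot Require Import Coquelicot.
Open Scope R_scope.

(** * Complex derivatives *)

(** The complex analysis rests on one tool: the mean value property, hence the maximum principle,
    for functions with a continuous complex derivative on a punctured disk that are merely
    continuous at its centre. Admitting the puncture lets difference quotients, their reciprocals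
    and Taylor remainders serve as test functions; their central values are [f'], [1 / f'] and
    [f'' / 2], so bounds on circles become bounds on derivatives.

    The constant 2 in Bieberbach's inequality is the limit of [1 + 1 / l]: a univalent self-map
    fixing 0 has derivative at most 1 in modulus, so the telescoped increments total at most
    [1 + 1 / l], and [l] tends to 1 with [rho]. The same bound stops the iteration, since every step
    multiplies the derivative by [1 / l > 1].

    Two points are topological: a nonvanishing function on the disk has a continuous square root,
    and an image containing the circle contains its interior. The second holds because
    [rho e^(it) - c] with [|c| < rho] has no continuous root around the circle. *)

Definition near (z : C) (P : C -> Prop) : Prop :=
  exists d, 0 < d /\ forall w, Cmod (w - z)%C < d -> P w.

Definition ccont (f : C -> C) (z : C) : Prop :=
  forall eps, 0 < eps -> near z (fun w => Cmod (f w - f z)%C < eps).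

(* Caratheodory's form of the derivative: the difference quotient extends
   continuously to [z]. *)
Definition cder (f : C -> C) (z l : C) : Prop :=
  exists phi, ccont phi z /\ phi z = l /\
    near z (fun w => f w = f z + (w - z) * phi w)%C.

Lemma near_imp z (P Q : C -> Prop) :
  (forall w, P w -> Q w) -> near z P -> near z Q.
Proof. intros H (d & Hd & K); exists d; split; auto. Qed.

Lemma near_and z P Q : near z P -> near z Q -> near z (fun w => P w /\ Q w).
Proof.
  intros (d & Hd & K) (e & He & L); exists (Rmin d e); split.
  - now apply Rmin_glb_lt.
  - intros w Hw; split; [apply K | apply L]; eapply Rlt_le_trans; eauto;
      [apply Rmin_l | apply Rmin_r].
Qed.

Lemma Cmod_self z : Cmod (z - z)%C = 0.
Proof. replace (z - z)%C with (RtoC 0) by ring; apply Cmod_0. Qed.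

Lemma near_self z P : near z P -> P z.
Proof. intros (d & Hd & K); apply K; rewrite Cmod_self; lra. Qed.

Lemma near_ball z r : 0 < r -> near z (fun w => Cmod (w - z)%C < r).
Proof. intros Hr; exists r; auto. Qed.

Lemma near_disk r z : disk r z -> near z (disk r).
Proof.
  unfold disk; intros Hz; exists (r - Cmod z); split; [lra|]; intros w Hw.
  replace w with ((w - z) + z)%C by ring.
  eapply Rle_lt_trans; [apply Cmod_triangle|]; lra.
Qed.

Lemma Cmod_sub_sym z w : Cmod (z - w)%C = Cmod (w - z)%C.
Proof. rewrite <- Cmod_opp; f_equal; ring. Qed.

Lemma Cmod_triangle_sub z w : Cmod z <= Cmod w + Cmod (z - w)%C.
Proof. replace z with (w + (z - w))%C at 1 by ring; apply Cmod_triangle. Qed.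

Lemma Cmod_sub_le z w : Cmod (z - w)%C <= Cmod z + Cmod w.
Proof.
  replace (z - w)%C with (z + - w)%C by ring.
  eapply Rle_trans; [apply Cmod_triangle|]; rewrite Cmod_opp; lra.
Qed.

Lemma Cmod_pos (z : C) : z <> 0%C -> 0 < Cmod z.
Proof. apply Cmod_gt_0. Qed.

Lemma Cminus_neq (z w : C) : z <> w -> (z - w <> 0)%C.
Proof. intros H K; apply H; replace z with (w + (z - w))%C by ring; rewrite K; ring. Qed.

Lemma ccont_comp f g z : ccont g z -> ccont f (g z) -> ccont (fun w => f (g w)) z.
Proof.
  intros Hg Hf eps He; destruct (Hf eps He) as (d & Hd & K).
  eapply near_imp; [|exact (Hg d Hd)]; intros w Hw; now apply K.
Qed.

Lemma near_comp g z P : ccont g z -> near (g z) P -> near z (fun w => P (g w)).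
Proof.
  intros Hg (d & Hd & K); eapply near_imp; [|exact (Hg d Hd)]; intros w Hw; now apply K.
Qed.

Lemma ccont_const c z : ccont (fun _ => c) z.
Proof. intros eps He; exists 1; split; [lra|]; intros; rewrite Cmod_self; lra. Qed.

Lemma ccont_id z : ccont (fun w => w) z.
Proof. intros eps He; now apply near_ball. Qed.

Lemma ccont_plus f g z : ccont f z -> ccont g z -> ccont (fun w => f w + g w)%C z.
Proof.
  intros Hf Hg eps He.
  eapply near_imp; [|exact (near_and _ _ _ (Hf (eps / 2) ltac:(lra)) (Hg (eps / 2) ltac:(lra)))].
  intros w [H K].
  replace (f w + g w - (f z + g z))%C with ((f w - f z) + (g w - g z))%C by ring.
  eapply Rle_lt_trans; [apply Cmod_triangle|]; lra.
Qed.

Lemma ccont_mult f g z : ccont f z -> ccont g z -> ccont (fun w => f w * g w)%C z.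
Proof.
  intros Hf Hg eps He.
  set (M := 1 + Cmod (f z) + Cmod (g z)).
  assert (HM : 1 <= M) by (unfold M; pose proof (Cmod_ge_0 (f z)); pose proof (Cmod_ge_0 (g z)); lra).
  assert (He2 : 0 < Rmin 1 (eps / (2 * M))).
  { apply Rmin_glb_lt; [lra|]; apply Rdiv_lt_0_compat; lra. }
  eapply near_imp; [|exact (near_and _ _ _ (Hf _ He2) (Hg _ He2))].
  intros w [H K].
  replace (f w * g w - f z * g z)%C
    with ((f w - f z) * (g w - g z) + ((f w - f z) * g z + f z * (g w - g z)))%C by ring.
  assert (E : eps / (2 * M) * M = eps / 2) by (field; lra).
  pose proof (Rmin_l 1 (eps / (2 * M))); pose proof (Rmin_r 1 (eps / (2 * M))).
  set (e := Rmin 1 (eps / (2 * M))) in *.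
  eapply Rle_lt_trans; [apply Cmod_triangle|].
  eapply Rle_lt_trans; [apply Rplus_le_compat_l, Cmod_triangle|].
  rewrite !Cmod_mult.
  pose proof (Cmod_ge_0 (f w - f z)%C); pose proof (Cmod_ge_0 (g w - g z)%C).
  pose proof (Cmod_ge_0 (f z)); pose proof (Cmod_ge_0 (g z)).
  apply Rle_lt_trans with (e * 1 + (e * Cmod (g z) + Cmod (f z) * e)).
  - repeat apply Rplus_le_compat; apply Rmult_le_compat; lra.
  - replace (e * 1 + (e * Cmod (g z) + Cmod (f z) * e)) with (e * M) by (unfold M; ring).
    assert (e * M <= eps / (2 * M) * M) by (apply Rmult_le_compat_r; lra). lra.
Qed.

Lemma ccont_opp f z : ccont f z -> ccont (fun w => - f w)%C z.
Proof.
  intros Hf eps He; eapply near_imp; [|exact (Hf eps He)]; intros w H.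
  replace (- f w - - f z)%C with (- (f w - f z))%C by ring; now rewrite Cmod_opp.
Qed.

Lemma ccont_minus f g z : ccont f z -> ccont g z -> ccont (fun w => f w - g w)%C z.
Proof. intros Hf Hg; apply (ccont_plus f (fun w => - g w)%C); auto using ccont_opp. Qed.

Lemma ccont_near_neq0 f z : ccont f z -> f z <> 0%C ->
  near z (fun w => Cmod (f z) / 2 < Cmod (f w)).
Proof.
  intros Hf H0; pose proof (Cmod_pos _ H0).
  eapply near_imp; [|exact (Hf (Cmod (f z) / 2) ltac:(lra))]; intros w H1.
  pose proof (Cmod_triangle_sub (f z) (f w)); cbv beta in H1; rewrite Cmod_sub_sym in H1; lra.
Qed.

Lemma ccont_inv f z : ccont f z -> f z <> 0%C -> ccont (fun w => / f w)%C z.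
Proof.
  intros Hf H0 eps He; pose proof (Cmod_pos _ H0) as Hp.
  set (m := Cmod (f z)) in *.
  assert (He2 : 0 < eps * (m * m / 2)) by (apply Rmult_lt_0_compat; nra).
  eapply near_imp; [|exact (near_and _ _ _ (ccont_near_neq0 f z Hf H0) (Hf _ He2))].
  intros w [H K]; fold m in H.
  assert (Hw : f w <> 0%C) by (apply Cmod_gt_0; lra).
  replace (/ f w - / f z)%C with (- (f w - f z) / (f w * f z))%C by (field; auto).
  rewrite Cmod_div, Cmod_opp, Cmod_mult by (apply Cmult_neq_0; auto); fold m.
  apply Rmult_lt_reg_r with (Cmod (f w) * m); [nra|].
  replace (Cmod (f w - f z) / (Cmod (f w) * m) * (Cmod (f w) * m)) with (Cmod (f w - f z)%C)
    by (field; lra).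
  eapply Rlt_le_trans; [exact K|]; apply Rmult_le_compat_l; nra.
Qed.

Lemma ccont_div f g z : ccont f z -> ccont g z -> g z <> 0%C -> ccont (fun w => f w / g w)%C z.
Proof. intros; apply (ccont_mult f (fun w => / g w)%C); auto using ccont_inv. Qed.

Lemma ccont_ext f g z : near z (fun w => f w = g w) -> ccont f z -> ccont g z.
Proof.
  intros H Hf eps He; pose proof (near_self _ _ H) as H0; simpl in H0.
  eapply near_imp; [|exact (near_and _ _ _ H (Hf eps He))]; intros w [K L]; congruence.
Qed.

Lemma ccont_lip f z : (forall w, Cmod (f w - f z)%C <= Cmod (w - z)%C) -> ccont f z.
Proof.
  intros H eps He; eapply near_imp; [|exact (near_ball z eps He)]; intros w K.
  simpl in K; specialize (H w); lra.
Qed.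

Lemma ccont_conj z : ccont Cconj z.
Proof.
  apply ccont_lip; intros w; replace (Cconj w - Cconj z)%C with (Cconj (w - z)).
  - rewrite Cmod_conj; lra.
  - unfold Cconj, Cminus, Cplus, Copp; simpl; f_equal; ring.
Qed.

Lemma cder_ccont f z l : cder f z l -> ccont f z.
Proof.
  intros (phi & Hc & H0 & Hn).
  apply ccont_ext with (fun w => f z + (w - z) * phi w)%C.
  - eapply near_imp; [|exact Hn]; intros; simpl; congruence.
  - apply ccont_plus; [apply ccont_const|]; apply ccont_mult; [|exact Hc].
    apply ccont_minus; [apply ccont_id|apply ccont_const].
Qed.

Lemma cder_const c z : cder (fun _ => c) z 0.
Proof.
  exists (fun _ => 0%C); repeat split; [apply ccont_const|].
  exists 1; split; [lra|]; intros; ring.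
Qed.

Lemma cder_id z : cder (fun w => w) z 1.
Proof.
  exists (fun _ => 1%C); repeat split; [apply ccont_const|].
  exists 1; split; [lra|]; intros; ring.
Qed.

Lemma cder_plus f g z l m : cder f z l -> cder g z m -> cder (fun w => f w + g w)%C z (l + m).
Proof.
  intros (phi & Hc & H0 & Hn) (psi & Kc & K0 & Kn).
  exists (fun w => phi w + psi w)%C; repeat split.
  - now apply ccont_plus.
  - congruence.
  - eapply near_imp; [|exact (near_and _ _ _ Hn Kn)]; intros w [E F]; rewrite E, F; ring.
Qed.

Lemma cder_mult f g z l m :
  cder f z l -> cder g z m -> cder (fun w => f w * g w)%C z (l * g z + f z * m).
Proof.
  intros (phi & Hc & H0 & Hn) Hg; pose proof (cder_ccont _ _ _ Hg) as Hgc.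
  destruct Hg as (psi & Kc & K0 & Kn).
  exists (fun w => phi w * g w + f z * psi w)%C; repeat split.
  - apply ccont_plus; apply ccont_mult; auto using ccont_const.
  - congruence.
  - eapply near_imp; [|exact (near_and _ _ _ Hn Kn)]; intros w [E F]; rewrite E, F; ring.
Qed.

Lemma cder_opp f z l : cder f z l -> cder (fun w => - f w)%C z (- l).
Proof.
  intros (phi & Hc & H0 & Hn); exists (fun w => - phi w)%C; repeat split.
  - now apply ccont_opp.
  - congruence.
  - eapply near_imp; [|exact Hn]; intros w E; rewrite E; ring.
Qed.

Lemma cder_minus f g z l m : cder f z l -> cder g z m -> cder (fun w => f w - g w)%C z (l - m).
Proof. intros Hf Hg; apply (cder_plus f (fun w => - g w)%C); auto using cder_opp. Qed.

Lemma cder_inv f z l : cder f z l -> f z <> 0%C -> cder (fun w => / f w)%C z (- l / (f z * f z)).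
Proof.
  intros Hf Hz; pose proof (cder_ccont _ _ _ Hf) as Hfc.
  destruct Hf as (phi & Hc & H0 & Hn).
  exists (fun w => - phi w / (f w * f z))%C; repeat split.
  - apply ccont_div; [now apply ccont_opp| |now apply Cmult_neq_0].
    apply ccont_mult; auto using ccont_const.
  - congruence.
  - eapply near_imp; [|exact (near_and _ _ _ Hn (ccont_near_neq0 f z Hfc Hz))]; intros w [E F].
    assert (Hw : f w <> 0%C) by (apply Cmod_gt_0; pose proof (Cmod_pos _ Hz); lra).
    replace (/ f w)%C with (/ f z - (f w - f z) / (f w * f z))%C by (field; auto).
    replace (f w - f z)%C with ((w - z) * phi w)%C by (rewrite E; ring); field; auto.
Qed.

Lemma cder_eq f z l m : cder f z l -> l = m -> cder f z m.
Proof. now intros H <-. Qed.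

Lemma cder_div f g z l m : cder f z l -> cder g z m -> g z <> 0%C ->
  cder (fun w => f w / g w)%C z ((l * g z - f z * m) / (g z * g z)).
Proof.
  intros Hf Hg Hz; eapply cder_eq; [exact (cder_mult _ _ _ _ _ Hf (cder_inv _ _ _ Hg Hz))|].
  cbv beta; field; auto.
Qed.

Lemma cder_comp f g z l m :
  cder g z m -> cder f (g z) l -> cder (fun w => f (g w)) z (l * m).
Proof.
  intros Hg (phi & Hc & H0 & Hn); pose proof (cder_ccont _ _ _ Hg) as Hgc.
  destruct Hg as (psi & Kc & K0 & Kn).
  exists (fun w => phi (g w) * psi w)%C; repeat split.
  - apply ccont_mult; auto; now apply (ccont_comp phi g).
  - congruence.
  - pose proof (near_comp _ _ _ Hgc Hn) as Hn2.
    eapply near_imp; [|exact (near_and _ _ _ Hn2 Kn)]; intros w [E F].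
    rewrite E; rewrite F at 1; ring.
Qed.

Lemma cder_ext f g z l : near z (fun w => f w = g w) -> cder f z l -> cder g z l.
Proof.
  intros H (phi & Hc & H0 & Hn); exists phi; repeat split; auto.
  pose proof (near_self _ _ H) as H1; simpl in H1.
  eapply near_imp; [|exact (near_and _ _ _ H Hn)]; intros w [E F]; congruence.
Qed.

Lemma ccont_eq_punctured f g z : ccont f z -> ccont g z ->
  near z (fun w => w <> z -> f w = g w) -> f z = g z.
Proof.
  intros Hf Hg Hn; apply NNPP; intros Hne; apply Cminus_neq in Hne.
  pose proof (Cmod_pos _ Hne) as Hp.
  destruct (near_and _ _ _ Hn (ccont_near_neq0 _ _ (ccont_minus _ _ _ Hf Hg) Hne))
    as (d & Hd & K).
  destruct (K (z + RtoC (d / 2))%C) as [E L].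
  - replace (z + RtoC (d / 2) - z)%C with (RtoC (d / 2)) by ring.
    rewrite Cmod_R, Rabs_pos_eq; lra.
  - rewrite E in L.
    + rewrite Cmod_self in L; lra.
    + intros F; assert (G : RtoC (d / 2) = 0%C).
      { replace (RtoC (d / 2)) with ((z + RtoC (d / 2)) - z)%C by ring; rewrite F; ring. }
      apply RtoC_inj in G; lra.
Qed.

Lemma cder_unique f z l m : cder f z l -> cder f z m -> l = m.
Proof.
  intros (phi & Hc & <- & Hn) (psi & Kc & <- & Kn).
  apply ccont_eq_punctured; auto.
  eapply near_imp; [|exact (near_and _ _ _ Hn Kn)]; intros w [E F] Hw.
  rewrite F in E.
  assert (G : ((w - z) * phi w = (w - z) * psi w)%C).
  { replace ((w - z) * phi w)%C with ((f z + (w - z) * phi w) - f z)%C by ring.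
    rewrite <- E; ring. }
  apply Cminus_neq in Hw.
  replace (phi w) with ((w - z) * phi w / (w - z))%C by (field; auto).
  rewrite G; field; auto.
Qed.

Definition twice_der (f f1 f2 : C -> C) (z : C) : Prop := cder f z (f1 z) /\ cder f1 z (f2 z).

(** Caratheodory's [phi] is only known to exist, while the test functions for the maximum principle
    are defined by cases; this identifies such an [F] with [phi] near [z]. *)
Lemma cder_quotient_ccont f z l :
  cder f z l ->
  forall F : C -> C, F z = l -> near z (fun w => w <> z -> F w = (f w - f z) / (w - z))%C ->
  ccont F z.
Proof.
  intros (phi & Hc & <- & Hn) F HF Hq.
  apply ccont_ext with phi; [|exact Hc].
  eapply near_imp; [|exact (near_and _ _ _ Hn Hq)]; intros w [E K].
  destruct (classic (w = z)) as [->|Hw]; [auto|].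
  rewrite (K Hw), E; field; now apply Cminus_neq.
Qed.

Lemma cderiv_cder f z l : cderiv f z l -> cder f z l.
Proof.
  intros [_ H].
  assert (Hlim : forall eps, 0 < eps -> near z (fun w =>
    Cmod (f w - f z - (w - z) * l)%C <= eps * Cmod (w - z)%C)).
  { intros eps He; destruct (H z (fun P HP => HP) (mkposreal eps He)) as [d Hd].
    exists d; split; [apply cond_pos|]; intros w Hw; exact (Hd w Hw). }
  (* The value [l] at [z] fills the removable singularity of the difference quotient. *)
  set (phi := fun w => if excluded_middle_informative (w = z) then l
     else ((f w - f z) / (w - z))%C).
  exists phi; unfold phi; repeat split.
  - intros eps He; eapply near_imp; [|exact (Hlim (eps / 2) ltac:(lra))]; intros w Hw.
    destruct (excluded_middle_informative (z = z)) as [_|N]; [|now elim N].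
    destruct (excluded_middle_informative (w = z)) as [E|N].
    + rewrite Cmod_self; lra.
    + apply Cminus_neq in N.
      replace ((f w - f z) / (w - z) - l)%C with ((f w - f z - (w - z) * l) / (w - z))%C
        by (field; auto).
      rewrite Cmod_div by auto; pose proof (Cmod_pos _ N).
      apply Rle_lt_trans with (eps / 2); [|lra].
      apply Rmult_le_reg_r with (Cmod (w - z)%C); [lra|].
      unfold Rdiv at 1; rewrite Rmult_assoc, Rinv_l, Rmult_1_r; lra.
  - now destruct (excluded_middle_informative (z = z)).
  - exists 1; split; [lra|]; intros w _.
    destruct (excluded_middle_informative (w = z)) as [->|N]; [ring|].
    field; now apply Cminus_neq.
Qed.

(** * The mean value property *)

Definition cis (t : R) : C := (cos t, sin t).

Lemma Cmod_cis t : Cmod (cis t) = 1.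
Proof.
  unfold Cmod, cis; simpl; pose proof (sin2_cos2 t) as H; unfold Rsqr in H.
  replace (cos t * (cos t * 1) + sin t * (sin t * 1)) with 1 by lra; apply sqrt_1.
Qed.

Lemma Cmod_circle w s t : 0 <= s -> Cmod (w + RtoC s * cis t - w)%C = s.
Proof.
  intros Hs; replace (w + RtoC s * cis t - w)%C with (RtoC s * cis t)%C by ring.
  rewrite Cmod_mult, Cmod_cis, Cmod_R, Rabs_pos_eq; lra.
Qed.

Lemma cis_2PI : cis (2 * PI) = cis 0.
Proof. unfold cis; now rewrite cos_2PI, sin_2PI, cos_0, sin_0. Qed.

(** Convergence of both coordinates suffices because [|g - c|] is at most the sum of their
    deviations. The filter is arbitrary so that the lemma serves one real variable, two real
    variables and the product topology of [C] alike. *)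
Lemma near_filter {T : Type} (Fl : (T -> Prop) -> Prop) {HF : Filter Fl}
  (g : T -> C) (c : C) P :
  filterlim (fun t => fst (g t)) Fl (locally (fst c)) ->
  filterlim (fun t => snd (g t)) Fl (locally (snd c)) ->
  near c P -> Fl (fun t => P (g t)).
Proof.
  intros H1 H2 (d & Hd & K).
  assert (Hd2 : 0 < d / 2) by lra.
  pose proof (H1 _ (locally_ball (fst c) (mkposreal _ Hd2))) as L1.
  pose proof (H2 _ (locally_ball (snd c) (mkposreal _ Hd2))) as L2.
  unfold filtermap in L1, L2.
  generalize (@filter_and _ Fl HF _ _ L1 L2); apply filter_imp; intros t [A B]; apply K.
  change (Rabs (fst (g t) - fst c) < d / 2) in A.
  change (Rabs (snd (g t) - snd c) < d / 2) in B.
  replace (g t - c)%C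
    with (RtoC (fst (g t) - fst c) + RtoC (snd (g t) - snd c) * Ci)%C.
  - eapply Rle_lt_trans; [apply Cmod_triangle|].
    rewrite Cmod_mult, Cmod_Ci, !Cmod_R; lra.
  - apply injective_projections; simpl; ring.
Qed.

Lemma ccont_filter_re {T : Type} (Fl : (T -> Prop) -> Prop) {HF : Filter Fl}
  (f : C -> C) (g : T -> C) (c : C) :
  ccont f c ->
  filterlim (fun t => fst (g t)) Fl (locally (fst c)) ->
  filterlim (fun t => snd (g t)) Fl (locally (snd c)) ->
  filterlim (fun t => Re (f (g t))) Fl (locally (Re (f c))).
Proof.
  intros Hf H1 H2 P [e He].
  pose proof (near_filter Fl g c _ H1 H2 (Hf e (cond_pos e))) as L.
  unfold filtermap; revert L; apply filter_imp; intros t Ht; apply He.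
  change (Rabs (Re (f (g t)) - Re (f c)) < e).
  replace (Re (f (g t)) - Re (f c)) with (Re (f (g t) - f c)%C)
    by (unfold Re, Cminus, Cplus, Copp; simpl; ring).
  eapply Rle_lt_trans; [apply re_le_Cmod|exact Ht].
Qed.

(** Multiplying by [- Ci] turns statements about imaginary parts into statements about real parts,
    so only the latter are proved directly. *)
Lemma Re_mult_mCi z : Re (- Ci * z)%C = Im z.
Proof. unfold Re, Im, Cmult, Copp, Ci; simpl; ring. Qed.

Lemma ccont_filter_im {T : Type} (Fl : (T -> Prop) -> Prop) {HF : Filter Fl}
  (f : C -> C) (g : T -> C) (c : C) :
  ccont f c ->
  filterlim (fun t => fst (g t)) Fl (locally (fst c)) ->
  filterlim (fun t => snd (g t)) Fl (locally (snd c)) ->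
  filterlim (fun t => Im (f (g t))) Fl (locally (Im (f c))).
Proof.
  intros Hf H1 H2.
  apply filterlim_ext with (fun t => Re (- Ci * f (g t))%C).
  { intros; apply Re_mult_mCi. }
  rewrite <- Re_mult_mCi.
  apply (ccont_filter_re Fl (fun z => - Ci * f z)%C); auto.
  apply ccont_mult; auto using ccont_const.
Qed.

(** * Derivatives along real curves *)

Lemma is_derive_caratheodory (g : R -> R) t a :
  is_derive g t a <->
  exists r : R -> R, continuous r t /\ r t = a /\ forall u : R, g u = g t + (u - t) * r u.
Proof.
  split.
  - intros H; apply is_derive_Reals in H.
    exists (fun u => if Req_dec_T u t then a else (g u - g t) / (u - t)); repeat split.
    + intros P [e He]; destruct (H e (cond_pos e)) as [d Hd].
      exists d; intros u Hu; apply He.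
      change (Rabs (u - t) < d) in Hu.
      destruct (Req_dec_T t t) as [_|N]; [|now elim N].
      destruct (Req_dec_T u t) as [E|N].
      * apply ball_center.
      * change (Rabs ((g u - g t) / (u - t) - a) < e).
        assert (N2 : u - t <> 0) by lra.
        specialize (Hd (u - t) N2 Hu); now rewrite Rplus_minus in Hd.
    + now destruct (Req_dec_T t t).
    + intros u; destruct (Req_dec_T u t) as [->|N]; [ring|]; field; lra.
  - intros (r & Hr & <- & E); apply is_derive_Reals.
    intros e He.
    destruct (Hr _ (locally_ball (r t) (mkposreal e He))) as [d Hd].
    exists d; intros h Hh Hd2.
    rewrite E; replace ((g t + (t + h - t) * r (t + h) - g t) / h) with (r (t + h)) by (field; auto).
    apply Hd; change (Rabs (t + h - t) < d); now replace (t + h - t) with h by ring.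
Qed.

(** The Caratheodory factors of [F] and of the two coordinates of [g] combine into one for the
    composite, so the chain rule takes no limit estimate. *)
Lemma cder_curve_re F (g : R -> C) t l a b :
  cder F (g t) l ->
  is_derive (fun u => fst (g u)) t a -> is_derive (fun u => snd (g u)) t b ->
  is_derive (fun u => Re (F (g u))) t (Re (l * (a, b))%C).
Proof.
  intros (phi & Hc & H0 & Hn) Ha Hb.
  assert (Ca : continuous (fun u => fst (g u)) t) by (apply (ex_derive_continuous (V := R_NormedModule)); now exists a).
  assert (Cb : continuous (fun u => snd (g u)) t) by (apply (ex_derive_continuous (V := R_NormedModule)); now exists b).
  pose proof (near_filter (locally t) g (g t) _ Ca Cb Hn) as Hl.
  apply is_derive_caratheodory in Ha; destruct Ha as (ra & Hra & Ra & Ea).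
  apply is_derive_caratheodory in Hb; destruct Hb as (rb & Hrb & Rb & Eb).
  apply is_derive_ext_loc
    with (fun u => Re (F (g t)) + (u - t) * (ra u * Re (phi (g u)) - rb u * Im (phi (g u)))).
  - revert Hl; apply filter_imp; intros u ->.
    rewrite re_plus, re_mult.
    replace (Re (g u - g t)) with ((u - t) * ra u)
      by (unfold Re, Cminus, Cplus, Copp; simpl; rewrite (Ea u); ring).
    replace (Im (g u - g t)) with ((u - t) * rb u)
      by (unfold Im, Cminus, Cplus, Copp; simpl; rewrite (Eb u); ring).
    simpl; ring.
  - apply is_derive_caratheodory.
    exists (fun u => ra u * Re (phi (g u)) - rb u * Im (phi (g u))); repeat split.
    + apply (continuous_minus (V := R_NormedModule));
        apply (continuous_mult (K := R_AbsRing)); auto.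
      * now apply (ccont_filter_re (locally t)).
      * now apply (ccont_filter_im (locally t)).
    + rewrite H0, Ra, Rb, re_mult; simpl; ring.
    + intros; ring.
Qed.

Lemma cder_curve_im F (g : R -> C) t l a b :
  cder F (g t) l ->
  is_derive (fun u => fst (g u)) t a -> is_derive (fun u => snd (g u)) t b ->
  is_derive (fun u => Im (F (g u))) t (Im (l * (a, b))%C).
Proof.
  intros H Ha Hb; rewrite <- Re_mult_mCi.
  apply is_derive_ext with (fun u => Re (- Ci * F (g u))%C); [intros; apply Re_mult_mCi|].
  rewrite Cmult_assoc; apply (cder_curve_re (fun z => - Ci * F z)%C); auto.
  eapply cder_eq; [apply cder_mult; [apply cder_const|exact H]|]; cbv beta; ring.
Qed.

Section Mean_value.
Variables (F F1 : C -> C) (w : C) (r : R).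
Hypothesis HF : forall z, 0 < Cmod (z - w)%C < r -> cder F z (F1 z) /\ ccont F1 z.

Let pt (s t : R) : C := (w + RtoC s * cis t)%C.

Lemma circle_point_fst s t : fst (pt s t) = fst w + s * cos t.
Proof. unfold pt, cis, RtoC, Cplus, Cmult; simpl; ring. Qed.

Lemma circle_point_snd s t : snd (pt s t) = snd w + s * sin t.
Proof. unfold pt, cis, RtoC, Cplus, Cmult; simpl; ring. Qed.

Lemma circle_point_in s t : 0 < s < r -> 0 < Cmod (pt s t - w)%C < r.
Proof. intros; unfold pt; rewrite Cmod_circle; lra. Qed.

Lemma derive_radial s t : 0 < s < r ->
  is_derive (fun u => Re (F (pt u t))) s (Re (F1 (pt s t) * cis t)%C).
Proof.
  intros Hs; apply (cder_curve_re F (fun u => pt u t)).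
  - apply HF; now apply circle_point_in.
  - apply is_derive_ext with (fun u => fst w + u * cos t); [intros; now rewrite circle_point_fst|].
    auto_derive; auto; ring.
  - apply is_derive_ext with (fun u => snd w + u * sin t); [intros; now rewrite circle_point_snd|].
    auto_derive; auto; ring.
Qed.

(** Cauchy-Riemann in polar form: the angular derivative of [Im F / s] is the radial derivative of
    [Re F]. *)
Lemma derive_angular s t : 0 < s < r ->
  is_derive (fun u => / s * Im (F (pt s u))) t (Re (F1 (pt s t) * cis t)%C).
Proof.
  intros Hs.
  replace (Re (F1 (pt s t) * cis t)%C)
    with (/ s * Im (F1 (pt s t) * ((- s * sin t)%R, (s * cos t)%R))%C).
  - apply is_derive_scal; apply (cder_curve_im F (fun u => pt s u)).
    + apply HF; now apply circle_point_in.
    + apply is_derive_ext with (fun u => fst w + s * cos u); [intros; now rewrite circle_point_fst|].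
      auto_derive; auto; ring.
    + apply is_derive_ext with (fun u => snd w + s * sin u); [intros; now rewrite circle_point_snd|].
      auto_derive; auto; ring.
  - rewrite im_mult, re_mult; unfold cis; simpl; field; lra.
Qed.

Lemma continuity_2d_on_circles s t (G : C -> C) : ccont G (pt s t) ->
  continuity_2d_pt (fun u v => Re (G (pt u v))) s t.
Proof.
  intros H; apply continuity_2d_pt_filterlim.
  apply (ccont_filter_re (locally (s, t)) G (fun z => pt (fst z) (snd z))); [exact H| |].
  - apply filterlim_ext with (fun z : R * R => fst w + fst z * cos (snd z)).
    { intros; now rewrite circle_point_fst. }
    rewrite circle_point_fst.
    apply (continuity_2d_pt_filterlim (fun a b => fst w + a * cos b)).
    apply continuity_2d_pt_plus; [apply continuity_2d_pt_const|].
    apply continuity_2d_pt_mult; [apply continuity_2d_pt_id1|].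
    apply continuity_1d_2d_pt_comp; [apply continuity_cos|apply continuity_2d_pt_id2].
  - apply filterlim_ext with (fun z : R * R => snd w + fst z * sin (snd z)).
    { intros; now rewrite circle_point_snd. }
    rewrite circle_point_snd.
    apply (continuity_2d_pt_filterlim (fun a b => snd w + a * sin b)).
    apply continuity_2d_pt_plus; [apply continuity_2d_pt_const|].
    apply continuity_2d_pt_mult; [apply continuity_2d_pt_id1|].
    apply continuity_1d_2d_pt_comp; [apply continuity_sin|apply continuity_2d_pt_id2].
Qed.

Lemma continuous_on_circle s t (G : C -> C) : ccont G (pt s t) -> continuous (fun v => Re (G (pt s v))) t.
Proof.
  intros H.
  apply (ccont_filter_re (locally t) G (fun v => pt s v)); [exact H| |].
  - apply filterlim_ext with (fun v : R => fst w + s * cos v).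
    { intros; now rewrite circle_point_fst. }
    rewrite circle_point_fst.
    apply (ex_derive_continuous (fun v => fst w + s * cos v)); auto_derive; auto.
  - apply filterlim_ext with (fun v : R => snd w + s * sin v).
    { intros; now rewrite circle_point_snd. }
    rewrite circle_point_snd.
    apply (ex_derive_continuous (fun v => snd w + s * sin v)); auto_derive; auto.
Qed.

Lemma radial_derivative_continuity_2d s t : 0 < s < r ->
  continuity_2d_pt (fun u v => Re (F1 (pt u v) * cis v)%C) s t.
Proof.
  intros Hs.
  apply continuity_2d_pt_ext
    with (fun u v => Re (F1 (pt u v)) * cos v - Re (- Ci * F1 (pt u v))%C * sin v).
  { intros; rewrite Re_mult_mCi, re_mult; unfold cis; simpl; ring. }
  assert (H1 : ccont F1 (pt s t)) by (apply HF; now apply circle_point_in).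
  apply continuity_2d_pt_minus; apply continuity_2d_pt_mult.
  - now apply continuity_2d_on_circles.
  - apply continuity_1d_2d_pt_comp; [apply continuity_cos|apply continuity_2d_pt_id2].
  - apply (continuity_2d_on_circles s t (fun z => - Ci * F1 z)%C); apply ccont_mult; auto using ccont_const.
  - apply continuity_1d_2d_pt_comp; [apply continuity_sin|apply continuity_2d_pt_id2].
Qed.

Lemma radial_derivative_continuous s t : 0 < s < r -> continuous (fun v => Re (F1 (pt s v) * cis v)%C) t.
Proof.
  intros Hs.
  apply continuous_ext
    with (fun v => Re (F1 (pt s v)) * cos v - Re (- Ci * F1 (pt s v))%C * sin v).
  { intros; rewrite Re_mult_mCi, re_mult; unfold cis; simpl; ring. }
  assert (H1 : ccont F1 (pt s t)) by (apply HF; now apply circle_point_in).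
  apply (continuous_minus (V := R_NormedModule)); apply (continuous_mult (K := R_AbsRing)).
  - now apply continuous_on_circle.
  - apply continuous_cos.
  - apply (continuous_on_circle s t (fun z => - Ci * F1 z)%C); apply ccont_mult; auto using ccont_const.
  - apply continuous_sin.
Qed.

Lemma circle_ex_RInt s : 0 < s < r -> ex_RInt (fun t => Re (F (pt s t))) 0 (2 * PI).
Proof.
  intros Hs; apply (ex_RInt_continuous (V := R_CompleteNormedModule)).
  intros t _; apply continuous_on_circle; apply cder_ccont with (F1 (pt s t)); apply HF; now apply circle_point_in.
Qed.

(** Differentiation under the integral leaves the radial derivative of [Re F], which is also the
    angular derivative of [Im F / s]. The latter function is periodic, so its derivative integrates
    to 0 over a full turn. *)
Lemma circle_mean_derive s : 0 < s < r ->
  is_derive (fun u => RInt (fun t => Re (F (pt u t))) 0 (2 * PI)) s 0.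
Proof.
  intros Hs.
  assert (Hloc : locally s (fun u => 0 < u < r)).
  { assert (Hd : 0 < Rmin s (r - s)) by (apply Rmin_glb_lt; lra).
    exists (mkposreal _ Hd); intros u Hu; change (Rabs (u - s) < Rmin s (r - s)) in Hu.
    pose proof (Rmin_l s (r - s)); pose proof (Rmin_r s (r - s)).
    apply Rabs_def2 in Hu; lra. }
  assert (E : RInt (fun t => Derive (fun u => Re (F (pt u t))) s) 0 (2 * PI) = 0).
  { apply is_RInt_unique.
    apply is_RInt_ext with (fun t => Re (F1 (pt s t) * cis t)%C).
    { intros t _; symmetry; now apply is_derive_unique, derive_radial. }
    assert (E : minus (/ s * Im (F (pt s (2 * PI)))) (/ s * Im (F (pt s 0))) = 0).
    { unfold pt; rewrite cis_2PI; apply (minus_eq_zero (G := R_AbelianGroup)). }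
    match goal with |- is_RInt ?f ?a ?b _ => apply (eq_ind _ (fun v => is_RInt f a b v)) with (2 := E) end.
    apply (is_RInt_derive (V := R_CompleteNormedModule) (fun t => / s * Im (F (pt s t)))).
    - intros t _; now apply derive_angular.
    - intros t _; now apply radial_derivative_continuous. }
  apply (eq_ind _ (fun v => is_derive _ s v)) with (2 := E).
  apply is_derive_RInt_param.
  - revert Hloc; apply filter_imp; intros u Hu t _.
    eexists; now apply derive_radial.
  - intros t _.
    apply continuity_2d_pt_ext_loc with (fun u v => Re (F1 (pt u v) * cis v)%C);
      [|now apply radial_derivative_continuity_2d].
    destruct Hloc as [d Hd]; exists d; intros u v Hu _.
    symmetry; apply is_derive_unique, derive_radial, Hd, Hu.
  - revert Hloc; apply filter_imp; intros u Hu; now apply circle_ex_RInt.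
Qed.

Lemma mean_value_re s : 0 < s < r -> ccont F w ->
  is_RInt (fun t => Re (F (w + RtoC s * cis t)%C)) 0 (2 * PI) (2 * PI * Re (F w)).
Proof.
  intros Hs Hw.
  set (J := fun u => RInt (fun t => Re (F (pt u t))) 0 (2 * PI)).
  pose proof PI_RGT_0 as Hpi.
  assert (HJ : J s = 2 * PI * Re (F w)).
  { apply NNPP; intros Hne.
    assert (He : 0 < Rabs (J s - 2 * PI * Re (F w)) / (4 * PI)).
    { apply Rdiv_lt_0_compat; [apply Rabs_pos_lt|]; lra. }
    (* The divisor [4 * PI] makes [2 * PI * e] half of the supposed deviation, which the estimate
       [B] then contradicts. *)
    set (e := Rabs (J s - 2 * PI * Re (F w)) / (4 * PI)) in *.
    destruct (Hw e He) as (d & Hd & K).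
    set (s' := Rmin (d / 2) (s / 2)).
    assert (Hs' : 0 < s') by (apply Rmin_glb_lt; lra).
    pose proof (Rmin_l (d / 2) (s / 2)); pose proof (Rmin_r (d / 2) (s / 2)).
    fold s' in H, H0.
    assert (E : J s' = J s).
    { apply (eq_is_derive (V := R_NormedModule)); [|lra].
      intros u Hu; apply circle_mean_derive; lra. }
    assert (B : Rabs (J s' - 2 * PI * Re (F w)) <= (2 * PI - 0) * e).
    { apply (norm_RInt_le_const (V := R_NormedModule)
        (fun t => Re (F (pt s' t)) - Re (F w)) 0 (2 * PI)); [lra| |].
      - intros t _; change (Rabs (Re (F (pt s' t)) - Re (F w)) <= e).
        replace (Re (F (pt s' t)) - Re (F w)) with (Re (F (pt s' t) - F w)%C)
          by (unfold Re, Cminus, Cplus, Copp; simpl; ring).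
        eapply Rle_trans; [apply re_le_Cmod|]; left; apply K.
        unfold pt; rewrite Cmod_circle; lra.
      - apply (is_RInt_minus (V := R_NormedModule)).
        + apply (RInt_correct (V := R_CompleteNormedModule)), circle_ex_RInt; lra.
        + replace (2 * PI * Re (F w)) with ((2 * PI - 0) * Re (F w)) by ring.
          apply (is_RInt_const (V := R_NormedModule)). }
    rewrite E in B; unfold e in B.
    pose proof (Rabs_pos_lt (J s - 2 * PI * Re (F w)) ltac:(lra)).
    replace ((2 * PI - 0) * (Rabs (J s - 2 * PI * Re (F w)) / (4 * PI)))
      with (Rabs (J s - 2 * PI * Re (F w)) / 2) in B by (field; lra).
    lra. }
  rewrite <- HJ; apply (RInt_correct (V := R_CompleteNormedModule)), circle_ex_RInt; lra.
Qed.

End Mean_value.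

(** * The maximum principle *)

Lemma unit_rotation z : exists m, Cmod m = 1 /\ (m * z)%C = RtoC (Cmod z).
Proof.
  destruct (classic (z = 0%C)) as [->|Hz].
  - exists 1%C; split; [apply Cmod_1|]; rewrite Cmod_0; ring.
  - pose proof (Cmod_pos _ Hz) as Hp.
    assert (Hn : RtoC (Cmod z) <> 0%C) by (intros E; apply RtoC_inj in E; lra).
    exists (Cconj z / RtoC (Cmod z))%C; split.
    + rewrite Cmod_div, Cmod_conj, Cmod_R, Rabs_pos_eq by (auto; lra); field; lra.
    + replace (Cconj z / RtoC (Cmod z) * z)%C with (z * Cconj z / RtoC (Cmod z))%C by (field; auto).
      rewrite <- Cmod2_conj, RtoC_pow; field; auto.
Qed.

(** A rotation makes [F w] real and nonnegative, after which the mean value property for real parts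
    bounds its modulus. *)
Lemma circle_max F F1 w r s M : 0 < s < r ->
  (forall z, 0 < Cmod (z - w)%C < r -> cder F z (F1 z) /\ ccont F1 z) ->
  ccont F w ->
  (forall z, Cmod (z - w)%C = s -> Cmod (F z) <= M) ->
  Cmod (F w) <= M.
Proof.
  intros Hs HF Hw HM; pose proof PI_RGT_0 as Hpi.
  destruct (unit_rotation (F w)) as (m & Hm & E).
  assert (HI : is_RInt (fun t => Re (m * F (w + RtoC s * cis t))%C) 0 (2 * PI)
                 (2 * PI * Re (m * F w)%C)).
  { apply (mean_value_re (fun z => m * F z)%C (fun z => m * F1 z)%C w r); auto.
    - intros z Hz; destruct (HF z Hz) as [H1 H2]; split.
      + eapply cder_eq; [apply cder_mult; [apply cder_const|exact H1]|]; cbv beta; ring.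
      + apply ccont_mult; auto using ccont_const.
    - apply ccont_mult; auto using ccont_const. }
  rewrite E, re_RtoC in HI.
  assert (2 * PI * Cmod (F w) <= (2 * PI - 0) * M).
  { apply (is_RInt_le _ (fun _ => M) 0 (2 * PI) _ _ ltac:(lra) HI).
    - apply (is_RInt_const (V := R_NormedModule)).
    - intros t _; eapply Rle_trans; [apply Rle_abs|]; eapply Rle_trans; [apply re_le_Cmod|].
      rewrite Cmod_mult, Hm, Rmult_1_l; apply HM, Cmod_circle; lra. }
  apply Rmult_le_reg_l with (2 * PI); lra.
Qed.

(** * Univalent functions *)

(** Compactness of the closed disk in a form meant for constants: the gauge [d] may encode a modulus
    of continuity, the reciprocal of an upper bound, or a lower bound, all of which survive
    shrinking [d]. *)
Lemma disk_uniform rho (Q : R -> C -> Prop) :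
  (forall d d' z, d <= d' -> Q d' z -> Q d z) ->
  (forall u, Cmod u <= rho -> exists d, 0 < d /\ forall z, Cmod (z - u)%C < d -> Q d z) ->
  exists d, 0 < d /\ forall z, Cmod z <= rho -> Q d z.
Proof.
  intros Hmono Hloc.
  (* The compactness lemma covers the square around the disk. Outside the disk the gauge is chosen
     so small that the ball of radius [2 * d] misses the disk; the factor 2 compares the modulus
     with two coordinate bounds. *)
  assert (H : forall u, exists d : posreal,
    (Cmod u <= rho -> forall z, Cmod (z - u)%C < 2 * d -> Q d z) /\
    (rho < Cmod u -> 2 * d <= Cmod u - rho)).
  { intros u; destruct (Rle_lt_dec (Cmod u) rho) as [Hu|Hu].
    - destruct (Hloc u Hu) as (d & Hd & K).
      assert (Hd2 : 0 < d / 2) by lra; exists (mkposreal _ Hd2); simpl; split; [|lra].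
      intros _ z Hz; apply Hmono with d; [lra|]; apply K; lra.
    - assert (Hd2 : 0 < (Cmod u - rho) / 2) by lra; exists (mkposreal _ Hd2); simpl; split; lra. }
  apply (@choice C posreal) in H; destruct H as (delta & H).
  destruct (compactness_value_2d (- rho) rho (- rho) rho (fun x y => delta (x, y))) as [d Hd].
  exists d; split; [apply cond_pos|]; intros z Hz.
  assert (Hx : - rho <= fst z <= rho).
  { pose proof (Rmax_Cmod z); pose proof (Rmax_l (Rabs (fst z)) (Rabs (snd z))).
    apply Rabs_le_between; lra. }
  assert (Hy : - rho <= snd z <= rho).
  { pose proof (Rmax_Cmod z); pose proof (Rmax_r (Rabs (fst z)) (Rabs (snd z))).
    apply Rabs_le_between; lra. }
  destruct (NNPP _ (Hd (fst z) (snd z) Hx Hy)) as (u & v & _ & _ & Hu & Hv & Hle).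
  destruct (H (u, v)) as [H1 H2].
  assert (Hdist : Cmod (z - (u, v))%C < 2 * delta (u, v)).
  { replace (z - (u, v))%C with (RtoC (fst z - u) + RtoC (snd z - v) * Ci)%C
      by (apply injective_projections; simpl; ring).
    eapply Rle_lt_trans; [apply Cmod_triangle|].
    rewrite Cmod_mult, Cmod_Ci, !Cmod_R; lra. }
  apply Hmono with (delta (u, v)); [exact Hle|].
  destruct (Rle_lt_dec (Cmod (u, v)) rho) as [Hin|Hout]; [now apply H1|].
  specialize (H2 Hout); exfalso.
  pose proof (Cmod_triangle_sub (u, v) z); rewrite Cmod_sub_sym in Hdist; lra.
Qed.

Lemma disk_bounded f rho :
  (forall z, Cmod z <= rho -> ccont f z) ->
  exists M, 0 < M /\ forall z, Cmod z <= rho -> Cmod (f z) <= M.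
Proof.
  intros Hf.
  destruct (disk_uniform rho (fun d z => d * Cmod (f z) <= 1)) as (d & Hd & K).
  - intros d d' z Hle H; eapply Rle_trans; [|exact H].
    apply Rmult_le_compat_r; [apply Cmod_ge_0|exact Hle].
  - intros u Hu; destruct (Hf u Hu 1 ltac:(lra)) as (e & He & L).
    pose proof (Cmod_ge_0 (f u)) as Hp.
    set (c := / (Cmod (f u) + 1)).
    assert (Hc : 0 < c) by (apply Rinv_0_lt_compat; lra).
    exists (Rmin e c); split; [now apply Rmin_glb_lt|]; intros z Hz.
    pose proof (Rmin_l e c); pose proof (Rmin_r e c).
    pose proof (Cmod_triangle_sub (f z) (f u)).
    specialize (L z ltac:(lra)); pose proof (Cmod_ge_0 (f z)).
    apply Rle_trans with (c * (Cmod (f u) + 1)).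
    + apply Rmult_le_compat; try lra.
      left; now apply Rmin_glb_lt.
    + unfold c; rewrite Rinv_l; lra.
  - exists (/ d); split; [now apply Rinv_0_lt_compat|]; intros z Hz.
    apply Rmult_le_reg_l with d; [exact Hd|]; rewrite Rinv_r by lra; now apply K.
Qed.

Lemma disk_unif_cont f rho :
  (forall z, Cmod z <= rho -> ccont f z) ->
  forall eps, 0 < eps -> exists d, 0 < d /\
    forall z w, Cmod z <= rho -> Cmod (w - z)%C < d -> Cmod (f w - f z)%C < eps.
Proof.
  intros Hf eps He.
  destruct (disk_uniform rho
    (fun d z => forall w, Cmod (w - z)%C < d -> Cmod (f w - f z)%C < eps)) as (d & Hd & K).
  - intros d d' z Hle H w Hw; apply H; lra.
  - intros u Hu; destruct (Hf u Hu (eps / 2) ltac:(lra)) as (e & He2 & L).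
    exists (e / 2); split; [lra|]; intros z Hz w Hw.
    replace (f w - f z)%C with ((f w - f u) - (f z - f u))%C by ring.
    eapply Rle_lt_trans; [apply Cmod_sub_le|].
    assert (H1 : Cmod (f w - f u)%C < eps / 2).
    { apply L; replace (w - u)%C with ((w - z) + (z - u))%C by ring.
      eapply Rle_lt_trans; [apply Cmod_triangle|]; lra. }
    assert (H2 : Cmod (f z - f u)%C < eps / 2) by (apply L; lra).
    lra.
  - exists d; split; [exact Hd|]; intros z w Hz; now apply K.
Qed.

Lemma circle_min G w s :
  (forall z, Cmod (z - w)%C = s -> ccont G z /\ G z <> 0%C) ->
  exists m, 0 < m /\ forall z, Cmod (z - w)%C = s -> m <= Cmod (G z).
Proof.
  intros HG.
  destruct (disk_uniform (Cmod w + s) (fun d z => Cmod (z - w)%C = s -> d <= Cmod (G z)))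
    as (d & Hd & K).
  - intros d d' z Hle H Hz; specialize (H Hz); lra.
  - intros u _; destruct (Req_dec (Cmod (u - w)%C) s) as [E|N].
    + destruct (HG u E) as [Hc H0]; pose proof (Cmod_pos _ H0) as Hp.
      destruct (ccont_near_neq0 G u Hc H0) as (e & He & L).
      exists (Rmin e (Cmod (G u) / 2)); split; [apply Rmin_glb_lt; lra|]; intros z Hz _.
      pose proof (Rmin_l e (Cmod (G u) / 2)); pose proof (Rmin_r e (Cmod (G u) / 2)).
      specialize (L z ltac:(lra)); lra.
    (* Away from the circle the gauge is the distance to it, so that the ball contains no point of
       the circle and the claim is vacuous. *)
    + exists (Rabs (Cmod (u - w)%C - s)); split; [apply Rabs_pos_lt; lra|].
      intros z Hz E; exfalso.
      pose proof (Cmod_triangle (u - z) (z - w)) as T1.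
      pose proof (Cmod_triangle (z - u) (u - w)) as T2.
      replace (u - z + (z - w))%C with (u - w)%C in T1 by ring.
      replace (z - u + (u - w))%C with (z - w)%C in T2 by ring.
      rewrite (Cmod_sub_sym u z) in T1; rewrite E in T1, T2.
      revert Hz; unfold Rabs; destruct Rcase_abs; lra.
  - exists d; split; [exact Hd|]; intros z Hz; apply K; auto.
    replace z with (w + (z - w))%C by ring; eapply Rle_trans; [apply Cmod_triangle|]; lra.
Qed.

(* If [w] were omitted, the maximum principle applied to [1 / (psi - w)] would
   bound its value at the centre by its values on a circle. *)
Lemma injective_open psi psi1 z r : 0 < r ->
  (forall u, Cmod (u - z)%C < r -> cder psi u (psi1 u) /\ ccont psi1 u) ->
  (forall u v, Cmod (u - z)%C < r -> Cmod (v - z)%C < r -> psi u = psi v -> u = v) ->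
  forall eps, 0 < eps -> near (psi z) (fun w => exists u, Cmod (u - z)%C < eps /\ psi u = w).
Proof.
  intros Hr Hd Hinj eps He.
  set (s := Rmin (r / 2) (eps / 2)).
  assert (Hs : 0 < s) by (apply Rmin_glb_lt; lra).
  assert (Hsr : s <= r / 2) by apply Rmin_l.
  assert (Hse : s <= eps / 2) by apply Rmin_r.
  destruct (circle_min (fun u => psi u - psi z)%C z s) as (m & Hm & Hmin).
  { intros u Hu; split.
    - apply ccont_minus; [|apply ccont_const].
      apply cder_ccont with (psi1 u), Hd; lra.
    - apply Cminus_neq; intros E; apply Hinj in E; [|lra|rewrite Cmod_self; lra].
      rewrite E, Cmod_self in Hu; lra. }
  (* An omitted [w] this close gives [|psi - w|] below [m / 4] at the centre but at least
     [3 * m / 4] on the circle. *)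
  exists (m / 4); split; [lra|]; intros w Hw.
  apply NNPP; intros Hno.
  assert (Hne : forall u, Cmod (u - z)%C < 3 / 2 * s -> (psi u - w <> 0)%C).
  { intros u Hu; apply Cminus_neq; intros E; apply Hno; exists u; split; [lra|exact E]. }
  assert (Hz : Cmod (z - z)%C < 3 / 2 * s) by (rewrite Cmod_self; lra).
  assert (HM : Cmod (/ (psi z - w))%C <= / (3 * m / 4)).
  { apply (circle_max (fun u => / (psi u - w))%C
      (fun u => - (psi1 u - 0) / ((psi u - w) * (psi u - w)))%C z (3 / 2 * s) s); [lra| | |].
    - intros u Hu; destruct (Hd u ltac:(lra)) as [H1 H2].
      assert (H3 : cder (fun u => psi u - w)%C u (psi1 u - 0)%C)
        by (apply cder_minus; [exact H1|apply cder_const]).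
      split; [apply (cder_inv (fun u => psi u - w)%C); [exact H3|apply Hne; lra]|].
      apply cder_ccont in H3.
      apply ccont_div.
      + apply ccont_opp, ccont_minus; auto using ccont_const.
      + now apply ccont_mult.
      + apply Cmult_neq_0; apply Hne; lra.
    - apply ccont_inv; [|now apply Hne].
      apply ccont_minus; [|apply ccont_const].
      apply cder_ccont with (psi1 z), Hd; lra.
    - intros u Hu; rewrite Cmod_inv by (apply Hne; lra).
      apply Rinv_le_contravar; [lra|].
      specialize (Hmin u Hu).
      replace (psi u - psi z)%C with ((psi u - w) + (w - psi z))%C in Hmin by ring.
      pose proof (Cmod_triangle (psi u - w) (w - psi z)); lra. }
  rewrite Cmod_inv in HM by now apply Hne.
  pose proof (Cmod_pos _ (Hne z Hz)) as Hp.
  rewrite Cmod_sub_sym in Hw.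
  assert (/ (3 * m / 4) < / Cmod (psi z - w)%C); [|lra].
  apply Rinv_lt_contravar; [apply Rmult_lt_0_compat|]; lra.
Qed.

(** Rotating [f w - f z] onto the positive axis reduces the claim to the real mean value theorem
    along the segment. *)
Lemma mean_value_inequality f f1 z w B :
  (forall t, 0 <= t <= 1 ->
    cder f (z + RtoC t * (w - z))%C (f1 (z + RtoC t * (w - z))%C) /\
    Cmod (f1 (z + RtoC t * (w - z))%C) <= B) ->
  Cmod (f w - f z)%C <= B * Cmod (w - z)%C.
Proof.
  intros H.
  destruct (unit_rotation (f w - f z)%C) as (m & Hm & E).
  set (g := fun t => (z + RtoC t * (w - z))%C) in *.
  set (v := (w - z)%C) in *.
  set (dg := fun t => Re (m * f1 (g t) * v)%C).
  assert (Hg : forall t, 0 <= t <= 1 -> is_derive (fun t => Re (m * f (g t))%C) t (dg t)).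
  { intros t Ht; unfold dg; replace v with (fst v, snd v) at 1 by (now destruct v).
    apply (cder_curve_re (fun u => m * f u)%C g).
    - destruct (H t Ht) as [H1 _]; eapply cder_eq; [apply cder_mult;
        [apply cder_const|exact H1]|]; cbv beta; unfold g, v; ring.
    - apply is_derive_ext with (fun t => fst z + t * fst v); [intros; unfold g, v; simpl; ring|].
      auto_derive; auto; unfold v; simpl; ring.
    - apply is_derive_ext with (fun t => snd z + t * snd v); [intros; unfold g, v; simpl; ring|].
      auto_derive; auto; unfold v; simpl; ring. }
  destruct (MVT_gen (fun t => Re (m * f (g t))%C) 0 1 dg) as (c & Hc & Ec).
  - intros t Ht; apply Hg; rewrite Rmin_left, Rmax_right in Ht; lra.
  - intros t Ht; rewrite Rmin_left, Rmax_right in Ht by lra.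
    apply derivable_continuous_pt; exists (dg t); apply is_derive_Reals, Hg; lra.
  - rewrite Rmin_left, Rmax_right in Hc by lra.
    assert (G1 : g 1 = w) by (unfold g, v; ring).
    assert (G0 : g 0 = z) by (unfold g, v; ring).
    rewrite G1, G0 in Ec.
    replace (Re (m * f w) - Re (m * f z)) with (Re (m * (f w - f z))%C) in Ec
      by (rewrite !re_mult; unfold Re, Im; simpl; ring).
    rewrite E, re_RtoC in Ec; rewrite Ec, Rminus_0_r, Rmult_1_r.
    eapply Rle_trans; [apply Rle_abs|]; eapply Rle_trans; [apply re_le_Cmod|].
    rewrite !Cmod_mult, Hm, Rmult_1_l.
    apply Rmult_le_compat_r; [apply Cmod_ge_0|apply (H c Hc)].
Qed.

Lemma Cmod_segment z w t : 0 <= t <= 1 ->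
  Cmod (z + RtoC t * (w - z) - z)%C <= Cmod (w - z)%C.
Proof.
  intros Ht; replace (z + RtoC t * (w - z) - z)%C with (RtoC t * (w - z))%C by ring.
  rewrite Cmod_mult, Cmod_R, Rabs_pos_eq by lra.
  pose proof (Cmod_ge_0 (w - z)%C); nra.
Qed.

(* At points [w] with [f1 w <> 0] the maximum principle for [(z - w) / (f z - f w)]
   bounds [|f1 w|] from below, locally uniformly in [w]; such points are dense. *)
Lemma injective_der_neq0 f f1 :
  (forall z, disk 1 z -> cder f z (f1 z) /\ ccont f1 z) ->
  (forall z w, disk 1 z -> disk 1 w -> f z = f w -> z = w) ->
  forall z, disk 1 z -> f1 z <> 0%C.
Proof.
  intros Hf Hinj z0 Hz0 H0.
  assert (Hz0' : Cmod z0 < 1) by exact Hz0.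
  pose proof (Cmod_ge_0 z0) as Hz0p.
  set (s := (1 - Cmod z0) / 4).
  assert (Hs : 0 < s) by (unfold s; lra).
  assert (Hin : forall z, Cmod (z - z0)%C < 4 * s -> disk 1 z).
  { intros z Hz; unfold disk; pose proof (Cmod_triangle_sub z z0); unfold s in Hz; lra. }
  destruct (circle_min (fun u => f u - f z0)%C z0 s) as (m & Hm & Hmin).
  { intros u Hu; split.
    - apply ccont_minus; [|apply ccont_const].
      apply cder_ccont with (f1 u), Hf, Hin; lra.
    - apply Cminus_neq; intros E; apply Hinj in E; [|apply Hin; lra|auto].
      rewrite E, Cmod_self in Hu; lra. }
  destruct (disk_unif_cont f (Cmod z0 + s)) with (eps := m / 4) as (d & Hd & Hu); [|lra|].
  { intros u Hu; apply cder_ccont with (f1 u), Hf; unfold disk, s in *; lra. }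
  (* The reciprocal difference quotient [F] has value [1 / f1 w] at [w]. On the circle of radius [s]
     about [w] its denominator is at least [m - 2 * (m / 4)], so the bound does not depend on
     [w]. *)
  assert (Hlow : forall w, Cmod (w - z0)%C < Rmin d s -> f1 w <> 0%C -> m / 2 <= s * Cmod (f1 w)).
  { intros w Hw Hne.
    assert (Hwd : Cmod (w - z0)%C < d) by (eapply Rlt_le_trans; [exact Hw|apply Rmin_l]).
    assert (Hws : Cmod (w - z0)%C < s) by (eapply Rlt_le_trans; [exact Hw|apply Rmin_r]).
    assert (Hw1 : disk 1 w) by (apply Hin; lra).
    assert (Hin2 : forall z, Cmod (z - w)%C < 2 * s -> disk 1 z).
    { intros z Hz; apply Hin; replace (z - z0)%C with ((z - w) + (w - z0))%C by ring.
      eapply Rle_lt_trans; [apply Cmod_triangle|]; lra. }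
    assert (Hnz : forall z, Cmod (z - w)%C < 2 * s -> z <> w -> (f z - f w <> 0)%C).
    { intros z Hz N; apply Cminus_neq; intros E; apply N, Hinj; auto. }
    set (F := fun z => if excluded_middle_informative (z = w) then (/ f1 w)%C
       else ((z - w) / (f z - f w))%C).
    assert (HB : Cmod (F w) <= s / (m / 2)).
    { apply (circle_max F (fun z => ((1 - 0) * (f z - f w) - (z - w) * (f1 z - 0))
          / ((f z - f w) * (f z - f w)))%C w (2 * s) s); [lra| | |].
      - intros z Hz.
        assert (Hzw : z <> w) by (intros ->; rewrite Cmod_self in Hz; lra).
        destruct (Hf z ltac:(apply Hin2; lra)) as [K1 K2].
        assert (K3 : cder (fun z => f z - f w)%C z (f1 z - 0)%C)
          by (apply cder_minus; [exact K1|apply cder_const]).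
        assert (K4 : cder (fun z => z - w)%C z (1 - 0)%C)
          by (apply cder_minus; [apply cder_id|apply cder_const]).
        assert (K5 : (f z - f w <> 0)%C) by (apply Hnz; auto; lra).
        split.
        + apply cder_ext with (fun z => (z - w) / (f z - f w))%C.
          * exists (Cmod (z - w)%C); split; [lra|]; intros u Hu2; unfold F.
            destruct (excluded_middle_informative (u = w)) as [->|_]; auto.
            rewrite Cmod_sub_sym in Hu2; lra.
          * exact (cder_div _ _ _ _ _ K4 K3 K5).
        + assert (J3 := cder_ccont _ _ _ K3); assert (J4 := cder_ccont _ _ _ K4).
          apply ccont_div; [|exact (ccont_mult _ _ _ J3 J3)|now apply Cmult_neq_0].
          apply (ccont_minus (fun z => (1 - 0) * (f z - f w))%C (fun z => (z - w) * (f1 z - 0))%C).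
          * exact (ccont_mult _ _ _ (ccont_const _ _) J3).
          * exact (ccont_mult _ _ _ J4 (ccont_minus _ _ _ K2 (ccont_const _ _))).
      - assert (HF : ccont (fun z => / (if excluded_middle_informative (z = w) then f1 w
           else ((f z - f w) / (z - w))))%C w).
        { apply ccont_inv; [|now destruct (excluded_middle_informative (w = w))].
          apply (cder_quotient_ccont f w (f1 w)); [now apply Hf| |].
          - now destruct (excluded_middle_informative (w = w)).
          - exists 1; split; [lra|]; intros u _ N.
            now destruct (excluded_middle_informative (u = w)). }
        revert HF; apply ccont_ext; exists (2 * s); split; [lra|]; intros u Hu2; unfold F.
        destruct (excluded_middle_informative (u = w)) as [_|N]; [reflexivity|].
        field; split; [apply Hnz; auto|now apply Cminus_neq].
      - intros z Hz; unfold F.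
        destruct (excluded_middle_informative (z = w)) as [->|N].
        { rewrite Cmod_self in Hz; lra. }
        assert (K5 : (f z - f w <> 0)%C) by (apply Hnz; auto; lra).
        rewrite Cmod_div, Hz by exact K5.
        apply Rmult_le_compat_l; [lra|]; apply Rinv_le_contravar; [lra|].
        (* Translating [z] puts it on the circle about [z0] where [Hmin] applies; uniform continuity
           charges [m / 4] for each of the two shifted values. *)
        set (zz := (z0 + (z - w))%C).
        assert (Hzz : Cmod (zz - z0)%C = s)
          by (unfold zz; replace (z0 + (z - w) - z0)%C with (z - w)%C by ring; exact Hz).
        specialize (Hmin zz Hzz).
        assert (A1 : Cmod (f z - f zz)%C < m / 4).
        { apply Hu.
          - replace zz with (z0 + (zz - z0))%C by ring.
            eapply Rle_trans; [apply Cmod_triangle|]; lra.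
          - unfold zz; replace (z - (z0 + (z - w)))%C with (w - z0)%C by ring; exact Hwd. }
        assert (A2 : Cmod (f w - f z0)%C < m / 4) by (apply Hu; lra).
        replace (f zz - f z0)%C with ((f z - f w) + ((f w - f z0) - (f z - f zz)))%C in Hmin by ring.
        pose proof (Cmod_triangle (f z - f w) ((f w - f z0) - (f z - f zz))).
        pose proof (Cmod_sub_le (f w - f z0) (f z - f zz)); lra. }
    unfold F in HB; destruct (excluded_middle_informative (w = w)) as [_|N]; [|now elim N].
    rewrite Cmod_inv in HB by exact Hne; pose proof (Cmod_pos _ Hne) as Hp.
    apply Rmult_le_compat_r with (r := m / 2 * Cmod (f1 w)) in HB; [|nra].
    replace (/ Cmod (f1 w) * (m / 2 * Cmod (f1 w))) with (m / 2) in HB by (field; lra).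
    replace (s / (m / 2) * (m / 2 * Cmod (f1 w))) with (s * Cmod (f1 w)) in HB by (field; lra).
    exact HB. }
  assert (Hd' : 0 < Rmin d s) by now apply Rmin_glb_lt.
  (* By [Hlow] the derivative is either 0 or bounded away from 0 near [z0]; being continuous with
     [f1 z0 = 0] it vanishes nearby, so [f] is locally constant, against injectivity. *)
  assert (Hzero : near z0 (fun w => f1 w = 0%C)).
  { assert (He : 0 < m / 4 / s) by (apply Rdiv_lt_0_compat; lra).
    destruct (Hf z0 Hz0) as [_ Hc]; pose proof (Hc _ He) as Hn.
    eapply near_imp; [|exact (near_and _ _ _ (near_ball z0 _ Hd') Hn)]; intros w [K1 K2].
    apply NNPP; intros Hne; specialize (Hlow w K1 Hne).
    rewrite H0 in K2; replace (f1 w - 0)%C with (f1 w) in K2 by ring.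
    assert (s * Cmod (f1 w) < s * (m / 4 / s)) by now apply Rmult_lt_compat_l.
    replace (s * (m / 4 / s)) with (m / 4) in H by (field; lra); lra. }
  destruct Hzero as (e & He & Hzero).
  set (e' := Rmin (e / 2) s).
  assert (He' : 0 < e') by (apply Rmin_glb_lt; lra).
  assert (He1 : e' <= e / 2) by apply Rmin_l.
  assert (He2 : e' <= s) by apply Rmin_r.
  set (w := (z0 + RtoC e')%C).
  assert (Hw : Cmod (w - z0)%C = e').
  { unfold w; replace (z0 + RtoC e' - z0)%C with (RtoC e') by ring; rewrite Cmod_R, Rabs_pos_eq; lra. }
  assert (Hc : Cmod (f w - f z0)%C <= 0 * Cmod (w - z0)%C).
  { apply (mean_value_inequality f f1); intros t Ht.
    pose proof (Cmod_segment z0 w t Ht) as Hseg; split.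
    - apply Hf, Hin; lra.
    - rewrite Hzero, Cmod_0; lra. }
  rewrite Rmult_0_l in Hc; pose proof (Cmod_ge_0 (f w - f z0)%C).
  assert (E : (f w - f z0)%C = 0%C) by (apply Cmod_eq_0; lra).
  assert (E2 : f w = f z0) by (replace (f w) with (f z0 + (f w - f z0))%C by ring; rewrite E; ring).
  apply Hinj in E2; [|apply Hin; lra|exact Hz0].
  rewrite E2, Cmod_self in Hw; lra.
Qed.

(** After subtracting the quadratic Taylor polynomial the derivative is [o(|u - z|)], since [f1] is
    differentiable at [z]; the mean value inequality then gives [o(|w - z|^2)]. *)
Lemma taylor2_ccont f f1 z l F :
  near z (fun w => cder f w (f1 w)) -> cder f1 z l ->
  F z = (l / 2)%C ->
  near z (fun w => w <> z -> F w = (f w - f z - (w - z) * f1 z) / ((w - z) * (w - z)))%C ->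
  ccont F z.
Proof.
  intros Hf (phi & Hc & Hl & Hn) HF HFw eps He.
  destruct (near_and _ _ _ Hf (near_and _ _ _ Hn (Hc (eps / 2) ltac:(lra)))) as (d & Hd & K).
  eapply near_imp; [|exact (near_and _ _ _ HFw (near_ball z d Hd))]; intros w [E Hw].
  destruct (classic (w = z)) as [->|N]; [rewrite Cmod_self; lra|].
  rewrite (E N), HF.
  pose proof (Cminus_neq _ _ N) as N2; pose proof (Cmod_pos _ N2) as Hp.
  set (k := fun u => (f u - (u - z) * f1 z - (u - z) * (u - z) * (l / 2))%C).
  set (k1 := fun u => (f1 u - f1 z - (u - z) * l)%C).
  assert (HB : Cmod (k w - k z)%C <= eps / 2 * Cmod (w - z)%C * Cmod (w - z)%C).
  { apply (mean_value_inequality k k1); intros t Ht.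
    pose proof (Cmod_segment z w t Ht) as Hseg.
    set (u := (z + RtoC t * (w - z))%C) in *.
    destruct (K u ltac:(lra)) as (K1 & K2 & K3); split.
    - unfold k, k1.
      assert (J : cder (fun u => u - z)%C u (1 - 0)%C)
        by (apply cder_minus; [apply cder_id|apply cder_const]).
      eapply cder_eq.
      + apply cder_minus; [apply cder_minus; [exact K1|]|].
        * apply cder_mult; [exact J|apply cder_const].
        * apply cder_mult; [apply cder_mult; exact J|apply cder_const].
      + cbv beta; field.
    - unfold k1; rewrite K2.
      replace (f1 z + (u - z) * phi u - f1 z - (u - z) * l)%C with ((u - z) * (phi u - phi z))%C
        by (rewrite Hl; ring).
      rewrite Cmod_mult, Rmult_comm; apply Rmult_le_compat; try apply Cmod_ge_0; lra. }
  replace ((f w - f z - (w - z) * f1 z) / ((w - z) * (w - z)) - l / 2)%C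
    with ((k w - k z) / ((w - z) * (w - z)))%C.
  - rewrite Cmod_div, Cmod_mult by now apply Cmult_neq_0.
    apply Rle_lt_trans with (eps / 2); [|lra].
    apply Rmult_le_reg_r with (Cmod (w - z) * Cmod (w - z)); [nra|].
    unfold Rdiv at 1; rewrite Rmult_assoc, Rinv_l by nra; lra.
  - unfold k; field; exact N2.
Qed.

Lemma der_punctured (n d : C -> C) (G : C -> C) n1 d1 z :
  cder n z (n1 z) -> ccont n1 z -> cder d z (d1 z) -> ccont d1 z -> d z <> 0%C ->
  near z (fun u => n u / d u = G u)%C ->
  cder G z ((n1 z * d z - n z * d1 z) / (d z * d z))%C /\
  ccont (fun z => (n1 z * d z - n z * d1 z) / (d z * d z))%C z.
Proof.
  intros Hn Hn1 Hd Hd1 H0 HG; split.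
  - exact (cder_ext _ _ _ _ HG (cder_div _ _ _ _ _ Hn Hd H0)).
  - pose proof (cder_ccont _ _ _ Hn); pose proof (cder_ccont _ _ _ Hd).
    apply ccont_div; [|now apply ccont_mult|now apply Cmult_neq_0].
    apply (ccont_minus (fun z => n1 z * d z)%C (fun z => n z * d1 z)%C);
      now apply ccont_mult.
Qed.

Lemma near_neq (z w : C) : z <> w -> near z (fun u => u <> w).
Proof.
  intros H; exists (Cmod (z - w)%C); split; [now apply Cmod_pos, Cminus_neq|].
  intros u Hu ->; rewrite Cmod_sub_sym in Hu; lra.
Qed.

(** * Second derivatives *)

(** The value at 0 is the limit, so that the maximum principle in [x] turns circle bounds into
    bounds on [f2 w]. *)
Definition taylor_rem (f f1 f2 : C -> C) (w x : C) : C :=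
  if excluded_middle_informative (x = 0%C) then (f2 w / 2)%C
  else ((f (w + x) - f w - x * f1 w) / (x * x))%C.

Lemma taylor_rem_0 f f1 f2 w : taylor_rem f f1 f2 w 0 = (f2 w / 2)%C.
Proof. unfold taylor_rem; destruct (excluded_middle_informative _) as [_|N]; [reflexivity|now elim N]. Qed.

Lemma taylor_rem_neq f f1 f2 (w x : C) : x <> 0%C ->
  taylor_rem f f1 f2 w x = ((f (w + x) - f w - x * f1 w) / (x * x))%C.
Proof. intros H; unfold taylor_rem; destruct (excluded_middle_informative _) as [E|_]; [contradiction|reflexivity]. Qed.

Lemma Cmod_pos_neq (z : C) : 0 < Cmod z -> z <> 0%C.
Proof. intros H ->; rewrite Cmod_0 in H; lra. Qed.

Lemma taylor_rem_ccont f f1 f2 w r : 0 < r ->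
  (forall z, Cmod (z - w)%C < r -> twice_der f f1 f2 z) ->
  ccont (taylor_rem f f1 f2 w) 0.
Proof.
  intros Hr Hf.
  assert (H : ccont (fun z => taylor_rem f f1 f2 w (z - w))%C w).
  { apply taylor2_ccont with (f := f) (f1 := f1) (l := f2 w).
    - exists r; split; [exact Hr|]; intros u Hu; now apply Hf.
    - apply Hf; rewrite Cmod_self; lra.
    - replace (w - w)%C with (RtoC 0) by ring; apply taylor_rem_0.
    - exists 1; split; [lra|]; intros u _ Hu.
      rewrite taylor_rem_neq by now apply Cminus_neq.
      now replace (w + (u - w))%C with u by ring. }
  apply (ccont_ext (fun x => (fun z => taylor_rem f f1 f2 w (z - w))%C (w + x)%C)).
  - exists 1; split; [lra|]; intros x _; cbv beta; f_equal; ring.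
  - apply (ccont_comp (fun z => taylor_rem f f1 f2 w (z - w))%C (fun x => w + x)%C).
    + apply ccont_plus; [apply ccont_const|apply ccont_id].
    + now replace (w + 0)%C with w by ring.
Qed.

Lemma taylor_rem_cder f f1 f2 w r :
  (forall z, Cmod (z - w)%C < r -> twice_der f f1 f2 z) ->
  exists T1, forall x, 0 < Cmod (x - 0)%C < r ->
    cder (taylor_rem f f1 f2 w) x (T1 x) /\ ccont T1 x.
Proof.
  intros Hf.
  set (n := fun x => (f (w + x) - f w - x * f1 w)%C).
  set (n1 := fun x => (f1 (w + x) - f1 w)%C).
  exists (fun x => ((n1 x * (x * x) - n x * (x + x)) / ((x * x) * (x * x)))%C).
  intros x [Hx0 Hxr]; replace (x - 0)%C with x in * by ring.
  apply Cmod_pos_neq in Hx0.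
  assert (Hin : Cmod (w + x - w)%C < r) by (replace (w + x - w)%C with x by ring; exact Hxr).
  destruct (Hf _ Hin) as [H1 H2].
  assert (Hs : cder (fun x => w + x)%C x 1%C).
  { eapply cder_eq; [apply cder_plus; [apply cder_const|apply cder_id]|]; cbv beta; ring. }
  apply (der_punctured n (fun x => x * x)%C _ n1 (fun x => x + x)%C).
  - unfold n, n1; eapply cder_eq.
    + apply cder_minus; [apply cder_minus; [|apply cder_const]|].
      * exact (cder_comp f (fun x => w + x)%C x _ _ Hs H1).
      * apply cder_mult; [apply cder_id|apply cder_const].
    + cbv beta; ring.
  - apply ccont_minus; [|apply ccont_const].
    apply (ccont_comp f1 (fun x => w + x)%C); [exact (cder_ccont _ _ _ Hs)|].
    exact (cder_ccont _ _ _ H2).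
  - eapply cder_eq; [apply cder_mult; apply cder_id|]; cbv beta; ring.
  - apply ccont_plus; apply ccont_id.
  - now apply Cmult_neq_0.
  - eapply near_imp; [|exact (near_neq x 0%C Hx0)]; intros u Hu.
    symmetry; now apply taylor_rem_neq.
Qed.

(** The difference of the Taylor remainders at [w] and [z0] has central value [(f2 w - f2 z0) / 2],
    while on the circle [|x| = s] it involves only increments of [f] and [f1]. The maximum principle
    thus passes continuity on to [f2]. *)
Lemma second_der_ccont f f1 f2 :
  (forall z, disk 1 z -> twice_der f f1 f2 z) ->
  forall z, disk 1 z -> ccont f2 z.
Proof.
  intros Hf z0 Hz0 eps He.
  assert (Hz0' : Cmod z0 < 1) by exact Hz0; pose proof (Cmod_ge_0 z0).
  set (s := (1 - Cmod z0) / 4).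
  assert (Hs : 0 < s) by (unfold s; lra).
  (* Three terms of size [e] over [s * s] bound half the increment of [f2], which leaves
     [3 / 4 * eps]. *)
  set (e := eps / 8 * (s * s)).
  assert (Hee : 0 < e) by (apply Rmult_lt_0_compat; nra).
  assert (Hcf : forall z, disk 1 z -> ccont f z)
    by (intros z Hz; apply cder_ccont with (f1 z); now apply Hf).
  assert (Hcf1 : forall z, disk 1 z -> ccont f1 z)
    by (intros z Hz; apply cder_ccont with (f2 z); now apply Hf).
  destruct (disk_unif_cont f (Cmod z0 + s)) with (eps := e) as (d & Hd & Hu); [|exact Hee|].
  { intros u Hu; apply Hcf; unfold disk, s in *; lra. }
  assert (Hes : 0 < e / s) by now apply Rdiv_lt_0_compat.
  eapply near_imp; [|exact (near_and _ _ _ (near_ball z0 _ Hd)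
    (near_and _ _ _ (near_ball z0 _ Hs) (Hcf1 z0 Hz0 _ Hes)))].
  intros w (Hwd & Hws & Hw1); cbv beta in Hwd, Hws, Hw1 |- *.
  assert (Hin : forall z, Cmod (z - z0)%C < 2 * s -> twice_der f f1 f2 z).
  { intros z Hz; apply Hf; unfold disk; pose proof (Cmod_triangle_sub z z0); unfold s in Hz; lra. }
  assert (Hinw : forall z, Cmod (z - w)%C < 2 * s -> twice_der f f1 f2 z).
  { intros z Hz; apply Hf; unfold disk; pose proof (Cmod_triangle_sub z w).
    pose proof (Cmod_triangle_sub w z0); unfold s in *; lra. }
  destruct (taylor_rem_cder f f1 f2 z0 (2 * s) Hin) as (T1 & HT).
  destruct (taylor_rem_cder f f1 f2 w (2 * s) Hinw) as (U1 & HU).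
  assert (HB : Cmod (taylor_rem f f1 f2 w 0 - taylor_rem f f1 f2 z0 0)%C <= 3 * e / (s * s)).
  { apply (circle_max (fun x => taylor_rem f f1 f2 w x - taylor_rem f f1 f2 z0 x)%C
      (fun x => U1 x - T1 x)%C 0%C (2 * s) s); [lra| | |].
    - intros x Hx; destruct (HT x Hx), (HU x Hx); split.
      + now apply cder_minus.
      + now apply ccont_minus.
    - apply ccont_minus; apply taylor_rem_ccont with (2 * s); auto; lra.
    - intros x Hx; replace (x - 0)%C with x in Hx by ring.
      assert (Hx0 : x <> 0%C) by (apply Cmod_pos_neq; lra).
      rewrite !taylor_rem_neq by exact Hx0.
      replace ((f (w + x) - f w - x * f1 w) / (x * x) - (f (z0 + x) - f z0 - x * f1 z0) / (x * x))%C
        with (((f (w + x) - f (z0 + x)) - ((f w - f z0) + x * (f1 w - f1 z0))) / (x * x))%C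
        by (field; exact Hx0).
      rewrite Cmod_div, Cmod_mult, Hx by now apply Cmult_neq_0.
      apply Rmult_le_compat_r; [left; apply Rinv_0_lt_compat; nra|].
      eapply Rle_trans; [apply Cmod_sub_le|].
      eapply Rle_trans; [apply Rplus_le_compat_l, Cmod_triangle|].
      rewrite Cmod_mult, Hx.
      assert (A1 : Cmod (f (w + x) - f (z0 + x))%C < e).
      { apply Hu.
        - eapply Rle_trans; [apply Cmod_triangle|]; lra.
        - replace (w + x - (z0 + x))%C with (w - z0)%C by ring; exact Hwd. }
      assert (A2 : Cmod (f w - f z0)%C < e) by (apply Hu; lra).
      assert (A3 : s * Cmod (f1 w - f1 z0)%C <= s * (e / s)) by (apply Rmult_le_compat_l; lra).
      replace (s * (e / s)) with e in A3 by (field; lra); lra. }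
  rewrite !taylor_rem_0 in HB.
  replace (f2 w / 2 - f2 z0 / 2)%C with ((f2 w - f2 z0) / 2)%C in HB by field.
  assert (H2 : RtoC 2 <> 0%C) by (intros E; apply RtoC_inj in E; lra).
  rewrite Cmod_div, Cmod_R, Rabs_pos_eq in HB by (exact H2 || lra).
  replace (3 * e / (s * s)) with (3 * eps / 8) in HB by (unfold e; field; lra).
  lra.
Qed.

(** * Estimates at the origin for bounded maps and for maps covering a disk *)

Lemma weight_integral c a b d : is_RInt (fun t => c + d * (a * cos t + b * sin t)) 0 (2 * PI) (2 * PI * c).
Proof.
  replace (2 * PI * c) with (minus (c * (2 * PI) + d * (a * sin (2 * PI) - b * cos (2 * PI)))
    (c * 0 + d * (a * sin 0 - b * cos 0))).
  - apply (is_RInt_derive (V := R_CompleteNormedModule)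
      (fun t => c * t + d * (a * sin t - b * cos t))).
    + intros t _; auto_derive; auto; ring.
    + intros t _; apply (ex_derive_continuous (V := R_NormedModule)); auto_derive; auto.
  - rewrite cos_2PI, sin_2PI, cos_0, sin_0; unfold minus, plus, opp; simpl; ring.
Qed.

(* Integrating [psi z / z] against the nonnegative weight
   [2 + e s / z + conj e z / s], which is real on [|z| = s]. *)
Lemma coefficient_bound_radius psi psi1 psi2 s :
  (forall z, disk 1 z -> twice_der psi psi1 psi2 z) -> psi 0%C = 0%C ->
  (forall z, disk 1 z -> Cmod (psi z) <= 1) -> 0 < s < 1 ->
  2 * Cmod (psi1 0%C) + s * Cmod (psi2 0 / 2)%C <= 2 / s.
Proof.
  intros Hd H0 Hb Hs.
  set (a1 := psi1 0%C); set (a2 := (psi2 0 / 2)%C).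
  destruct (unit_rotation a1) as (m & Hm & Em).
  destruct (unit_rotation (m * a2)%C) as (e & He & Ee).
  rewrite Cmod_mult, Hm, Rmult_1_l in Ee.
  assert (Hd0 : forall z, Cmod (z - 0)%C < 1 -> twice_der psi psi1 psi2 z).
  { intros z Hz; apply Hd; unfold disk; now replace z with (z - 0)%C by ring. }
  set (T := taylor_rem psi psi1 psi2 0).
  destruct (taylor_rem_cder psi psi1 psi2 0%C 1 Hd0) as (T1 & HT); fold T in HT.
  assert (HTc : ccont T 0) by (apply (taylor_rem_ccont _ _ _ _ 1 ltac:(lra) Hd0)).
  assert (HT0 : T 0%C = a2) by apply taylor_rem_0.
  set (k := (Cconj e / RtoC s)%C).
  (* This is [m] times the weighted [psi z / z] with its pole [m * a1 * e * s / z] removed, hence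
     continuous at 0. The removed term reappears on the circle in [EG]. *)
  set (G := fun z => (m * (2 * (a1 + z * T z) + (e * s * T z + k * psi z)))%C).
  set (G1 := fun z => (m * (2 * (T z + z * T1 z) + (e * s * T1 z + k * psi1 z)))%C).
  assert (HG : is_RInt (fun t => Re (G (0 + RtoC s * cis t))%C) 0 (2 * PI) (2 * PI * Re (G 0%C))).
  { apply (mean_value_re G G1 0%C 1); [|exact Hs|].
    - intros z Hz; destruct (HT z Hz) as [J1 J2]; destruct (Hd0 z (proj2 Hz)) as [J3 J4].
      pose proof (cder_ccont _ _ _ J1); pose proof (cder_ccont _ _ _ J4); split.
      + unfold G, G1; eapply cder_eq.
        * apply cder_mult; [apply cder_const|]; apply cder_plus.
          -- apply cder_mult; [apply cder_const|]; apply cder_plus; [apply cder_const|].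
             apply cder_mult; [apply cder_id|exact J1].
          -- apply cder_plus; apply cder_mult; [apply cder_const|exact J1|apply cder_const|exact J3].
        * cbv beta; ring.
      + repeat first [apply ccont_mult | apply ccont_plus | apply ccont_const | apply ccont_id | assumption].
    - assert (ccont psi 0).
      { destruct (Hd 0%C) as [J _]; [unfold disk; rewrite Cmod_0; lra|]; exact (cder_ccont _ _ _ J). }
      repeat first [apply ccont_mult | apply ccont_plus | apply ccont_const | apply ccont_id | assumption]. }
  assert (HG0 : Re (G 0%C) = 2 * Cmod a1 + s * Cmod a2).
  { unfold G; rewrite HT0, H0.
    replace (m * (2 * (a1 + 0 * a2) + (e * s * a2 + k * 0)))%C
      with (2 * (m * a1) + s * (e * (m * a2)))%C by ring.
    rewrite Em, Ee, re_plus, !re_scal_l, !re_RtoC; ring. }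
  rewrite HG0 in HG.
  assert (Hsne : RtoC s <> 0%C) by (intros E; apply RtoC_inj in E; lra).
  (* With [2 + 2 * x] the weight on the circle, the integrand is at most
     [(2 + 2 * x) / s - |a1| * x], which is this function with [x] as its trigonometric part. *)
  assert (HW := weight_integral (2 / s) (Re e) (Im e) (2 / s - Cmod a1)).
  pose proof PI_RGT_0 as Hpi.
  apply Rmult_le_reg_l with (2 * PI); [lra|].
  apply (is_RInt_le _ _ 0 (2 * PI) _ _ ltac:(lra) HG HW).
  intros t _.
  set (z := (0 + RtoC s * cis t)%C).
  assert (Ez : z = (RtoC s * cis t)%C) by (unfold z; ring).
  assert (Hz : Cmod z = s) by (rewrite Ez, Cmod_mult, Cmod_cis, Cmod_R, Rabs_pos_eq; lra).
  assert (Hz0 : z <> 0%C) by (apply Cmod_pos_neq; lra).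
  assert (Hcc : (cis t * Cconj (cis t) = 1)%C).
  { rewrite <- Cmod2_conj, Cmod_cis; apply injective_projections; simpl; ring. }
  assert (Hc0 : cis t <> 0%C) by (apply Cmod_pos_neq; rewrite Cmod_cis; lra).
  assert (Hci : (/ cis t = Cconj (cis t))%C).
  { replace (/ cis t)%C with (/ cis t * (cis t * Cconj (cis t)))%C by (rewrite Hcc; ring).
    field; exact Hc0. }
  set (x := Re e * cos t + Im e * sin t).
  assert (Hx : (e * Cconj (cis t) + Cconj e * cis t)%C = RtoC (2 * x)).
  { unfold x, Cconj, cis, Re, Im; destruct e; apply injective_projections; simpl; ring. }
  assert (Hrx : Re (e * Cconj (cis t))%C = x).
  { unfold x, Cconj, cis, Re, Im; destruct e; simpl; ring. }
  assert (EG : G z = (RtoC (2 + 2 * x) * (m * psi z / z) - RtoC (Cmod a1) * (e * Cconj (cis t)))%C).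
  { unfold G, T; rewrite taylor_rem_neq by exact Hz0.
    rewrite RtoC_plus, <- Hx, <- Em, <- Hci; fold a1.
    rewrite H0; replace (0 + z)%C with z by ring.
    unfold k; rewrite Ez; set (p := psi (RtoC s * cis t)%C); field; auto. }
  rewrite EG.
  replace (Re (RtoC (2 + 2 * x) * (m * psi z / z) - RtoC (Cmod a1) * (e * Cconj (cis t)))%C)
    with ((2 + 2 * x) * Re (m * psi z / z)%C - Cmod a1 * x).
  - assert (Hxb : -1 <= x).
    { pose proof (re_le_Cmod (e * Cconj (cis t))%C) as J.
      rewrite Hrx, Cmod_mult, He, Cmod_conj, Cmod_cis in J.
      apply Rabs_le_between in J; lra. }
    assert (HR : Re (m * psi z / z)%C <= / s).
    { eapply Rle_trans; [apply Rle_abs|]; eapply Rle_trans; [apply re_le_Cmod|].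
      rewrite Cmod_div, Cmod_mult, Hm, Hz by exact Hz0.
      assert (Cmod (psi z) <= 1) by (apply Hb; unfold disk; lra).
      pose proof (Rinv_0_lt_compat s ltac:(lra)); unfold Rdiv; nra. }
    assert ((2 + 2 * x) * Re (m * psi z / z)%C <= (2 + 2 * x) * / s)
      by (apply Rmult_le_compat_l; lra).
    unfold Rdiv; fold x; lra.
  - rewrite <- Hrx at 2; unfold Cminus; rewrite re_plus.
    rewrite <- (re_scal_l (2 + 2 * x)), <- (re_scal_l (Cmod a1)); unfold Re; simpl; ring.
Qed.

(** The limit [s -> 1] of [coefficient_bound_radius]. It is weaker than the sharp [1 - |psi1 0|^2],
    but it still forces [|psi1 0| <= 1] and makes the second coefficient small when [|psi1 0|] is
    near 1. *)
Lemma coefficient_bound psi psi1 psi2 :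
  (forall z, disk 1 z -> twice_der psi psi1 psi2 z) -> psi 0%C = 0%C ->
  (forall z, disk 1 z -> Cmod (psi z) <= 1) ->
  Cmod (psi2 0 / 2)%C <= 2 * (1 - Cmod (psi1 0%C)).
Proof.
  intros Hd H0 Hb.
  pose proof (coefficient_bound_radius psi psi1 psi2) as H.
  set (p := Cmod (psi1 0%C)) in *; set (q := Cmod (psi2 0 / 2)%C) in *.
  assert (Hp : 0 <= p) by apply Cmod_ge_0; assert (Hq : 0 <= q) by apply Cmod_ge_0.
  apply Rnot_lt_le; intros Hlt.
  set (X := 2 * p + q); assert (HX : 2 < X) by (unfold X; lra).
  (* For [s = 1 - k] this makes [s * s * X] exceed [(X + 2) / 2 > 2]. *)
  set (k := (X - 2) / (4 * X)).
  assert (E : k * X = (X - 2) / 4) by (unfold k; field; lra).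
  assert (Hk : 0 < k) by (apply Rdiv_lt_0_compat; lra).
  set (s := 1 - k).
  assert (Hs : 0 < s < 1) by (unfold s; split; nra).
  specialize (H s Hd H0 Hb Hs).
  apply Rmult_le_compat_l with (r := s) in H; [|lra].
  replace (s * (2 / s)) with 2 in H by (field; lra).
  assert (H1 : s * (s * p) <= 1 * (s * p)) by (apply Rmult_le_compat_r; [apply Rmult_le_pos|]; lra).
  assert (H2 : s * (s * X) <= 2) by (unfold X; lra).
  replace (s * (s * X)) with (X - 2 * (k * X) + k * (k * X)) in H2 by (unfold s; ring).
  rewrite E in H2; assert (0 < k * ((X - 2) / 4)) by (apply Rmult_lt_0_compat; lra); lra.
Qed.

(** By openness each point near [w] is a value of [psi] near [g w], and injectivity forces [g] to
    pick that preimage. *)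
Lemma ccont_inverse psi psi1 (g : C -> C) w :
  (forall z, disk 1 z -> cder psi z (psi1 z) /\ ccont psi1 z) ->
  (forall u v, disk 1 u -> disk 1 v -> psi u = psi v -> u = v) ->
  near w (fun w => disk 1 (g w) /\ psi (g w) = w) ->
  ccont g w.
Proof.
  intros Hd Hinj Hn eps He.
  destruct (near_self _ _ Hn) as [Hg Eg].
  assert (Hg' : Cmod (g w) < 1) by exact Hg.
  set (r := 1 - Cmod (g w)).
  assert (Hin : forall u, Cmod (u - g w)%C < r -> disk 1 u).
  { intros u Hu; unfold disk; pose proof (Cmod_triangle_sub u (g w)); unfold r in Hu; lra. }
  assert (Hr : 0 < r) by (unfold r; lra).
  assert (Hopen := injective_open psi psi1 (g w) r Hr
    (fun u Hu => Hd u (Hin u Hu)) (fun u v Hu Hv => Hinj u v (Hin u Hu) (Hin v Hv))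
    (Rmin eps r) ltac:(now apply Rmin_glb_lt)).
  rewrite Eg in Hopen.
  eapply near_imp; [|exact (near_and _ _ _ Hn Hopen)]; intros v [[Hv Ev] (u & Hu & Eu)].
  pose proof (Rmin_l eps r); pose proof (Rmin_r eps r).
  replace (g v) with u; [lra|].
  apply Hinj; [apply Hin; lra|exact Hv|congruence].
Qed.

(** Schwarz's lemma for the inverse on [disk rho]: its derivative at 0 is [1 / psi1 0] and has
    modulus at most [1 / rho]. *)
Lemma inner_radius_le_der psi psi1 rho : 0 < rho ->
  (forall z, disk 1 z -> cder psi z (psi1 z) /\ ccont psi1 z) ->
  (forall u v, disk 1 u -> disk 1 v -> psi u = psi v -> u = v) ->
  psi 0%C = 0%C ->
  (forall w, disk rho w -> exists z, disk 1 z /\ psi z = w) ->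
  rho <= Cmod (psi1 0%C).
Proof.
  intros Hrho Hd Hinj H0 Hsurj.
  assert (Hne : forall z, disk 1 z -> psi1 z <> 0%C) by now apply (injective_der_neq0 psi).
  assert (Hch : forall w, exists z, disk rho w -> disk 1 z /\ psi z = w).
  { intros w; destruct (classic (disk rho w)) as [Hw|Hw].
    - destruct (Hsurj w Hw) as (z & Hz); now exists z.
    - exists 0%C; tauto. }
  apply (@choice C C) in Hch; destruct Hch as (g & Hg).
  assert (Hgc : forall w, disk rho w -> ccont g w).
  { intros w Hw; apply (ccont_inverse psi psi1); auto.
    eapply near_imp; [|exact (near_disk _ _ Hw)]; exact Hg. }
  assert (D0 : disk 1 0) by (unfold disk; rewrite Cmod_0; lra).
  assert (R0 : disk rho 0) by (unfold disk; rewrite Cmod_0; lra).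
  assert (G0 : g 0%C = 0%C) by (apply Hinj; auto; [|rewrite H0]; now apply Hg).
  set (g1 := fun w => (/ psi1 (g w))%C).
  assert (Hg1 : forall w, disk rho w -> cder g w (g1 w)).
  { intros w Hw; destruct (Hg w Hw) as [Hgw Egw].
    destruct (Hd (g w) Hgw) as [(phi & Hphi & Ephi & Hn) _].
    pose proof (ccont_comp phi g w (Hgc w Hw) Hphi) as Hpg.
    assert (Hp0 : phi (g w) <> 0%C) by (rewrite Ephi; now apply Hne).
    exists (fun v => / phi (g v))%C; repeat split.
    - now apply ccont_inv.
    - unfold g1; now rewrite Ephi.
    - eapply near_imp; [|exact (near_and _ _ _ (near_disk _ _ Hw)
        (near_and _ _ _ (near_comp g w _ (Hgc w Hw) Hn) (ccont_near_neq0 _ _ Hpg Hp0)))].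
      intros v (Hv & E & Hpv).
      assert (Hpv0 : phi (g v) <> 0%C) by (apply Cmod_gt_0; pose proof (Cmod_pos _ Hp0); lra).
      destruct (Hg v Hv) as [_ Egv]; rewrite Egv, Egw in E.
      set (y := ((g v - g w) * phi (g v))%C) in E.
      replace (v - w)%C with y by (rewrite E; ring); unfold y.
      field; exact Hpv0. }
  assert (Hg1c : forall w, disk rho w -> ccont g1 w).
  { intros w Hw; destruct (Hg w Hw) as [Hgw _]; apply ccont_inv; [|now apply Hne].
    apply (ccont_comp psi1 g); [now apply Hgc|now apply Hd]. }
  apply Rnot_lt_le; intros Hlt.
  pose proof (Cmod_pos _ (Hne 0%C D0)) as Hp.
  (* A radius strictly between [|psi1 0|] and [rho] already yields the contradiction
     [1 / |psi1 0| <= 1 / s]. *)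
  set (s := (rho + Cmod (psi1 0%C)) / 2).
  set (F := fun w : C => if excluded_middle_informative (w = 0%C) then g1 0%C else (g w / w)%C).
  assert (HB : Cmod (F 0%C) <= / s).
  { apply (circle_max F (fun w => (g1 w * w - g w * 1) / (w * w))%C 0%C rho s);
      [unfold s; lra| | |].
    - intros w Hw; replace (w - 0)%C with w in Hw by ring.
      assert (Hw0 : w <> 0%C) by (now apply Cmod_pos_neq).
      assert (Hwr : disk rho w) by (unfold disk; lra).
      apply (der_punctured g (fun w => w) F g1 (fun _ => 1%C)); auto using cder_id, ccont_const.
      eapply near_imp; [|exact (near_neq w 0%C Hw0)]; intros u Hu; unfold F.
      now destruct (excluded_middle_informative (u = 0%C)).
    - apply (cder_quotient_ccont g 0%C (g1 0%C)); [now apply Hg1| |].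
      + unfold F; now destruct (excluded_middle_informative (RtoC 0 = 0%C)).
      + exists 1; split; [lra|]; intros u _ Hu; unfold F.
        destruct (excluded_middle_informative (u = 0%C)); [contradiction|].
        rewrite G0; f_equal; ring.
    - intros w Hw; replace (w - 0)%C with w in Hw by ring.
      assert (Hw0 : w <> 0%C) by (apply Cmod_pos_neq; unfold s in Hw; lra).
      unfold F; destruct (excluded_middle_informative (w = 0%C)); [contradiction|].
      rewrite Cmod_div, Hw by exact Hw0.
      destruct (Hg w) as [Hgw _]; [unfold disk; unfold s in Hw; lra|]; unfold disk in Hgw.
      pose proof (Rinv_0_lt_compat s ltac:(unfold s; lra)); unfold Rdiv; nra. }
  unfold F in HB; destruct (excluded_middle_informative (RtoC 0 = 0%C)) as [_|N]; [|now elim N].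
  unfold g1 in HB; rewrite G0, Cmod_inv in HB by now apply Hne.
  assert (/ s < / Cmod (psi1 0%C)); [|lra].
  apply Rinv_lt_contravar; [apply Rmult_lt_0_compat|]; unfold s; lra.
Qed.

(** * Square roots *)

(** The half-angle formula gives the principal root. Where [|w| + Re w = 0], on the closed negative
    real axis, it degenerates and a purely imaginary root is taken instead. *)
Lemma csqrt_exists : exists r : C -> C,
  (forall w, (r w * r w)%C = w) /\ (forall w, 0 < Re w -> 0 < Re (r w)).
Proof.
  exists (fun w => if Rlt_dec 0 (Cmod w + Re w)
    then (sqrt ((Cmod w + Re w) / 2), Im w / (2 * sqrt ((Cmod w + Re w) / 2)))
    else (0, sqrt (- Re w))).
  split; intros w.
  - pose proof (Cmod2_alt w) as Hm.
    pose proof (re_le_Cmod w) as Hre; apply Rabs_le_between in Hre.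
    destruct (Rlt_dec 0 (Cmod w + Re w)) as [H|H].
    + set (A := (Cmod w + Re w) / 2).
      assert (HA : 0 < A) by (unfold A; lra).
      pose proof (sqrt_lt_R0 A HA) as Hs; pose proof (sqrt_sqrt A ltac:(lra)) as Hss.
      set (a := sqrt A) in *.
      apply injective_projections; simpl.
      * change (a * a - Im w / (2 * a) * (Im w / (2 * a)) = Re w).
        apply Rmult_eq_reg_r with (4 * (a * a)); [|nra].
        replace ((a * a - Im w / (2 * a) * (Im w / (2 * a))) * (4 * (a * a)))
          with (4 * (a * a) * (a * a) - Im w ^ 2) by (field; lra).
        rewrite Hss; unfold A; nra.
      * change (a * (Im w / (2 * a)) + Im w / (2 * a) * a = Im w); field; lra.
    + assert (E : Cmod w = - Re w) by lra.
      assert (Hi : Im w = 0) by (rewrite E in Hm; nra).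
      pose proof (Cmod_ge_0 w).
      apply injective_projections; simpl.
      * rewrite sqrt_sqrt by lra; unfold Re; ring.
      * change (0 * sqrt (- Re w) + sqrt (- Re w) * 0 = Im w); rewrite Hi; ring.
  - intros Hw; pose proof (Cmod_ge_0 w).
    destruct (Rlt_dec 0 (Cmod w + Re w)); [|lra].
    simpl; apply sqrt_lt_R0; lra.
Qed.

Definition csqrt : C -> C := proj1_sig (constructive_indefinite_description _ csqrt_exists).

Lemma csqrt_sqr w : (csqrt w * csqrt w)%C = w.
Proof. unfold csqrt; destruct constructive_indefinite_description as [r Hr]; apply Hr. Qed.

Lemma csqrt_re w : 0 < Re w -> 0 < Re (csqrt w).
Proof. unfold csqrt; destruct constructive_indefinite_description as [r Hr]; apply Hr. Qed.

Lemma Re_near w : 0 < Re w -> near w (fun v => 0 < Re v).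
Proof.
  intros Hw; exists (Re w); split; [exact Hw|]; intros v Hv.
  pose proof (re_le_Cmod (v - w)%C) as H.
  replace (Re (v - w)) with (Re v - Re w) in H by (unfold Re; simpl; ring).
  apply Rabs_le_between in H; lra.
Qed.

(** In [(csqrt v - csqrt w) * (csqrt v + csqrt w) = v - w] the second factor has modulus at least
    [Re (csqrt w)], because both roots lie in the right half-plane. *)
Lemma csqrt_ccont w : 0 < Re w -> ccont csqrt w.
Proof.
  intros Hw eps He; pose proof (csqrt_re w Hw) as Hr.
  assert (He2 : 0 < eps * Re (csqrt w)) by now apply Rmult_lt_0_compat.
  eapply near_imp; [|exact (near_and _ _ _ (Re_near w Hw) (near_ball w _ He2))].
  intros v [Hv Hd]; pose proof (csqrt_re v Hv) as Hrv.
  assert (H : Re (csqrt w) <= Cmod (csqrt v + csqrt w)%C).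
  { eapply Rle_trans; [|apply re_le_Cmod]; rewrite re_plus, Rabs_pos_eq; lra. }
  apply Rmult_lt_reg_r with (Re (csqrt w)); [exact Hr|].
  eapply Rle_lt_trans; [apply Rmult_le_compat_l; [apply Cmod_ge_0|exact H]|].
  rewrite <- Cmod_mult.
  replace ((csqrt v - csqrt w) * (csqrt v + csqrt w))%C with (v - w)%C; [exact Hd|].
  rewrite <- (csqrt_sqr v), <- (csqrt_sqr w) at 1; ring.
Qed.

Lemma Cmult_integral (z w : C) : (z * w = 0)%C -> z = 0%C \/ w = 0%C.
Proof.
  intros H; destruct (classic (z = 0%C)) as [|Hz]; [now left|right].
  apply NNPP; intros Hw; now apply (Cmult_neq_0 z w).
Qed.

Lemma sqr_eq_cases (z w : C) : (z * z = w * w)%C -> z = w \/ z = (- w)%C.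
Proof.
  intros H; assert (E : ((z - w) * (z + w) = 0)%C).
  { replace ((z - w) * (z + w))%C with (z * z - w * w)%C by ring; rewrite H; ring. }
  apply Cmult_integral in E; destruct E as [E|E]; [left|right].
  - replace z with ((z - w) + w)%C by ring; rewrite E; ring.
  - replace z with ((z + w) - w)%C by ring; rewrite E; ring.
Qed.

Lemma csqrt_1 : csqrt 1 = 1%C.
Proof.
  destruct (sqr_eq_cases (csqrt 1) 1%C) as [E|E]; [rewrite csqrt_sqr; ring|exact E|].
  pose proof (csqrt_re 1%C ltac:(simpl; lra)) as H; rewrite E in H; simpl in H; lra.
Qed.

(** * Continuous square roots along paths and on the disk *)

Definition rcont (g : R -> C) (t : R) : Prop :=
  continuous (fun u => fst (g u)) t /\ continuous (fun u => snd (g u)) t.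

Lemma rcont_comp (f : C -> C) g t : ccont f (g t) -> rcont g t -> rcont (fun u => f (g u)) t.
Proof.
  intros Hf [H1 H2]; split.
  - now apply (ccont_filter_re (locally t) f g (g t)).
  - now apply (ccont_filter_im (locally t) f g (g t)).
Qed.

Lemma rcont_mult g h t : rcont g t -> rcont h t -> rcont (fun u => (g u * h u)%C) t.
Proof.
  intros [G1 G2] [H1 H2]; split; simpl.
  - apply (continuous_minus (V := R_NormedModule)); now apply (continuous_mult (K := R_AbsRing)).
  - apply (continuous_plus (V := R_NormedModule)); now apply (continuous_mult (K := R_AbsRing)).
Qed.

Lemma rcont_linear (a b : C) t : rcont (fun u => (a + RtoC u * b)%C) t.
Proof.
  split; simpl; apply (ex_derive_continuous (V := R_NormedModule)); auto_derive; auto.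
Qed.

Lemma rcont_cis t : rcont cis t.
Proof. split; simpl; [apply continuous_cos|apply continuous_sin]. Qed.

(* The quotient of two continuous square roots of a nonvanishing function is a
   continuous function with values in {1, -1}. *)
Lemma sqrt_path_unique (x y : R -> C) a b : a < b ->
  (forall t, a <= t <= b -> rcont x t) -> (forall t, a <= t <= b -> rcont y t) ->
  (forall t, a <= t <= b -> (x t * x t = y t * y t)%C) ->
  (forall t, a <= t <= b -> y t <> 0%C) ->
  x a = y a -> x b = y b.
Proof.
  intros Hab Hx Hy E H0 Ea.
  destruct (sqr_eq_cases (x b) (y b)) as [|Eb]; [apply E; lra|assumption|].
  (* The real inner product of the two roots is positive where they agree, negative where they are
     opposite, and never 0; the intermediate value theorem excludes a change of sign. *)
  set (s := fun t => fst (x t) * fst (y t) + snd (x t) * snd (y t)).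
  assert (Hp : forall t, a <= t <= b -> 0 < fst (y t) * fst (y t) + snd (y t) * snd (y t)).
  { intros t Ht; pose proof (Cmod2_alt (y t)) as J; pose proof (Cmod_pos _ (H0 t Ht)).
    change (Cmod (y t) ^ 2 = fst (y t) ^ 2 + snd (y t) ^ 2) in J; nra. }
  destruct (IVT_interv (fun t => - s t) a b) as (t & Ht & Hst).
  - intros t Ht; apply continuity_pt_filterlim.
    destruct (Hx t Ht), (Hy t Ht).
    apply (continuous_opp (V := R_NormedModule)), (continuous_plus (V := R_NormedModule));
      now apply (continuous_mult (K := R_AbsRing)).
  - exact Hab.
  - unfold s; rewrite Ea; pose proof (Hp a ltac:(lra)); lra.
  - unfold s; rewrite Eb; simpl; pose proof (Hp b ltac:(lra)); lra.
  - exfalso; pose proof (Hp t Ht).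
    destruct (sqr_eq_cases _ _ (E t Ht)) as [F|F]; unfold s in Hst; rewrite F in Hst;
      simpl in Hst; lra.
Qed.

(** The index runs outwards along the radius of [z]: stage [k] is meant as a root of [F (k / N z)],
    continued from the constant [csqrt (F 0)]. *)
Fixpoint sqrt_chain (F : C -> C) (N : nat) (k : nat) (z : C) : C :=
  match k with
  | O => csqrt (F 0%C)
  | S j => (sqrt_chain F N j z *
      csqrt (F (RtoC (INR (S j) / INR N) * z) / F (RtoC (INR j / INR N) * z)))%C
  end.

(* [q] is the product of the principal roots of [F ((j+1)/N z) / F (j/N z)], which
   are close to 1 for large [N] by uniform continuity. *)
Lemma sqrt_closed_disk F rho : 0 < rho < 1 ->
  (forall z, disk 1 z -> ccont F z /\ F z <> 0%C) ->
  exists q : C -> C, q 0%C = csqrt (F 0%C) /\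
    forall z, Cmod z <= rho -> (q z * q z)%C = F z /\ ccont q z.
Proof.
  intros Hrho HF.
  assert (Hin : forall z, Cmod z <= rho -> disk 1 z) by (intros z Hz; unfold disk; lra).
  destruct (disk_bounded (fun z => / F z)%C rho) as (M & HM & HB).
  { intros z Hz; destruct (HF z (Hin z Hz)); now apply ccont_inv. }
  (* As [M] bounds [1 / F], increments below [/ M] keep each ratio within distance 1 of 1, hence in
     the right half-plane where [csqrt] is continuous. *)
  destruct (disk_unif_cont F rho) with (eps := / M) as (d & Hd & Hu).
  { intros z Hz; now apply HF, Hin. }
  { now apply Rinv_0_lt_compat. }
  destruct (INR_unbounded (/ d)) as (N & HN).
  assert (HN0 : 0 < INR N) by (pose proof (Rinv_0_lt_compat d Hd); lra).
  assert (HNd : / INR N < d).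
  { rewrite <- (Rinv_inv d); apply Rinv_lt_contravar; [|lra].
    apply Rmult_lt_0_compat; [now apply Rinv_0_lt_compat|exact HN0]. }
  assert (Hfr : forall j, (j <= N)%nat -> 0 <= INR j / INR N <= 1).
  { intros j Hj; apply le_INR in Hj; pose proof (pos_INR j); split.
    - apply Rdiv_le_0_compat; lra.
    - apply Rmult_le_reg_r with (INR N); [exact HN0|].
      unfold Rdiv; rewrite Rmult_assoc, Rinv_l; lra. }
  assert (Hsc : forall j z, (j <= N)%nat -> Cmod z <= rho ->
    Cmod (RtoC (INR j / INR N) * z)%C <= rho).
  { intros j z Hj Hz; rewrite Cmod_mult, Cmod_R; pose proof (Hfr j Hj).
    rewrite Rabs_pos_eq by lra; pose proof (Cmod_ge_0 z); nra. }
  assert (Hratio : forall j z, (S j <= N)%nat -> Cmod z <= rho ->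
    0 < Re (F (RtoC (INR (S j) / INR N) * z) / F (RtoC (INR j / INR N) * z))%C).
  { intros j z Hj Hz.
    set (u := (RtoC (INR j / INR N) * z)%C); set (v := (RtoC (INR (S j) / INR N) * z)%C).
    assert (Hu1 : Cmod u <= rho) by (apply Hsc; [lia|exact Hz]).
    destruct (HF u (Hin u Hu1)) as [_ Hu0].
    assert (Huv : Cmod (F v - F u)%C < / M).
    { apply Hu; [exact Hu1|].
      replace (v - u)%C with (RtoC (/ INR N) * z)%C.
      - rewrite Cmod_mult, Cmod_R, Rabs_pos_eq by (left; now apply Rinv_0_lt_compat).
        pose proof (Cmod_ge_0 z); pose proof (Rinv_0_lt_compat _ HN0); nra.
      - unfold u, v; rewrite S_INR.
        replace ((INR j + 1) / INR N) with (INR j / INR N + / INR N) by (field; lra).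
        rewrite RtoC_plus; ring. }
    assert (Hc : Cmod ((F v - F u) * / F u)%C < 1).
    { rewrite Cmod_mult; specialize (HB u Hu1); cbv beta in HB.
      pose proof (Cmod_ge_0 (F v - F u)%C); pose proof (Cmod_ge_0 (/ F u)%C).
      apply Rle_lt_trans with (Cmod (F v - F u)%C * M); [now apply Rmult_le_compat_l|].
      apply Rmult_lt_compat_r with (r := M) in Huv; [|exact HM].
      rewrite Rinv_l in Huv; lra. }
    replace (F v / F u)%C with (1 + (F v - F u) * / F u)%C by (field; exact Hu0).
    rewrite re_plus; pose proof (re_le_Cmod ((F v - F u) * / F u)%C) as J.
    apply Rabs_le_between in J; simpl (Re 1); lra. }
  assert (Hk : forall k z, (k <= N)%nat -> Cmod z <= rho ->
    (sqrt_chain F N k z * sqrt_chain F N k z)%C = F (RtoC (INR k / INR N) * z)%C /\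
    ccont (sqrt_chain F N k) z).
  { induction k as [|k IH]; intros z Hk Hz.
    - split; [|apply ccont_const]; simpl sqrt_chain; rewrite csqrt_sqr; f_equal.
      simpl; unfold Rdiv; rewrite Rmult_0_l; ring.
    - destruct (IH z ltac:(lia) Hz) as [IH1 IH2].
      pose proof (Hin _ (Hsc k z ltac:(lia) Hz)) as Hk1.
      pose proof (Hin _ (Hsc (S k) z Hk Hz)) as Hk2.
      destruct (HF _ Hk1) as [Hc1 Hn1]; destruct (HF _ Hk2) as [Hc2 Hn2].
      split.
      + cbn [sqrt_chain].
        set (c := csqrt _).
        replace (sqrt_chain F N k z * c * (sqrt_chain F N k z * c))%C
          with ((sqrt_chain F N k z * sqrt_chain F N k z) * (c * c))%C by ring.
        unfold c; rewrite csqrt_sqr, IH1; field; exact Hn1.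
      + apply (ccont_mult (sqrt_chain F N k) (fun z =>
          csqrt (F (RtoC (INR (S k) / INR N) * z) / F (RtoC (INR k / INR N) * z)))%C); [exact IH2|].
        apply (ccont_comp csqrt (fun z =>
          F (RtoC (INR (S k) / INR N) * z) / F (RtoC (INR k / INR N) * z))%C);
          [|now apply csqrt_ccont, Hratio].
        apply ccont_div; [| |exact Hn1].
        * apply (ccont_comp F (fun z => RtoC (INR (S k) / INR N) * z)%C); [|exact Hc2].
          apply ccont_mult; [apply ccont_const|apply ccont_id].
        * apply (ccont_comp F (fun z => RtoC (INR k / INR N) * z)%C); [|exact Hc1].
          apply ccont_mult; [apply ccont_const|apply ccont_id]. }
  exists (sqrt_chain F N N); split.
  - assert (D0 : disk 1 0) by (unfold disk; rewrite Cmod_0; lra).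
    assert (G : forall k, sqrt_chain F N k 0%C = csqrt (F 0%C)); [|apply G].
    induction k as [|k IH]; [reflexivity|]; cbn [sqrt_chain]; rewrite IH, !Cmult_0_r.
    replace (F 0 / F 0)%C with (RtoC 1) by (field; now apply HF).
    rewrite csqrt_1; ring.
  - intros z Hz; destruct (Hk N z ltac:(lia) Hz) as [H1 H2]; split; [|exact H2].
    rewrite H1; f_equal; replace (INR N / INR N) with 1 by (field; lra); ring.
Qed.

(** The roots on closed disks share the value [csqrt (F 0)] at the centre, so they agree along every
    radius by uniqueness on paths and can be glued. *)
Lemma sqrt_disk F :
  (forall z, disk 1 z -> ccont F z /\ F z <> 0%C) ->
  exists q, forall z, disk 1 z -> (q z * q z)%C = F z /\ ccont q z.
Proof.
  intros HF.
  assert (H : forall rho, exists q : C -> C, 0 < rho < 1 -> q 0%C = csqrt (F 0%C) /\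
    forall z, Cmod z <= rho -> (q z * q z)%C = F z /\ ccont q z).
  { intros rho; destruct (classic (0 < rho < 1)) as [Hr|Hr].
    - destruct (sqrt_closed_disk F rho Hr HF) as (q & Hq); now exists q.
    - exists (fun z => z); tauto. }
  apply (@choice R (C -> C)) in H; destruct H as (Q & HQ).
  (* A radius strictly larger than [|z|], so that one fixed root [Q (rad z)] represents the glued
     function on a whole neighbourhood of [z]. *)
  set (rad := fun z => (1 + Cmod z) / 2).
  assert (Hrad : forall z, disk 1 z -> Cmod z < rad z /\ 0 < rad z < 1).
  { intros z Hz; unfold disk in Hz; unfold rad; pose proof (Cmod_ge_0 z); lra. }
  assert (Huniq : forall r s z, 0 < r < 1 -> 0 < s < 1 -> Cmod z <= r -> Cmod z <= s ->
    Q r z = Q s z).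
  { intros r s z Hr Hs Hzr Hzs.
    destruct (HQ r Hr) as [Hr0 Hrq]; destruct (HQ s Hs) as [Hs0 Hsq].
    assert (E1 : (0 + RtoC 1 * z)%C = z) by ring; assert (E0 : (0 + RtoC 0 * z)%C = 0%C) by ring.
    assert (Hsc : forall t, 0 <= t <= 1 -> Cmod (0 + RtoC t * z)%C <= Cmod z).
    { intros t Ht; replace (0 + RtoC t * z)%C with (RtoC t * z)%C by ring.
      rewrite Cmod_mult, Cmod_R, Rabs_pos_eq by lra; pose proof (Cmod_ge_0 z); nra. }
    rewrite <- E1.
    apply (sqrt_path_unique (fun t => Q r (0 + RtoC t * z)%C) (fun t => Q s (0 + RtoC t * z)%C) 0 1);
      [lra| | | | |].
    - intros t Ht; apply (rcont_comp (Q r) (fun t => 0 + RtoC t * z)%C); [|apply rcont_linear].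
      apply Hrq; specialize (Hsc t Ht); lra.
    - intros t Ht; apply (rcont_comp (Q s) (fun t => 0 + RtoC t * z)%C); [|apply rcont_linear].
      apply Hsq; specialize (Hsc t Ht); lra.
    - intros t Ht; specialize (Hsc t Ht).
      destruct (Hrq (0 + RtoC t * z)%C ltac:(lra)) as [-> _].
      destruct (Hsq (0 + RtoC t * z)%C ltac:(lra)) as [-> _]; reflexivity.
    - intros t Ht E; specialize (Hsc t Ht).
      destruct (Hsq (0 + RtoC t * z)%C ltac:(lra)) as [K _]; rewrite E, Cmult_0_l in K.
      apply (proj2 (HF (0 + RtoC t * z)%C ltac:(unfold disk; lra))); now symmetry.
    - rewrite E0, Hr0, Hs0; reflexivity. }
  exists (fun z => Q (rad z) z); intros z Hz.
  destruct (Hrad z Hz) as [Hz1 Hz2]; destruct (HQ _ Hz2) as [_ Hq].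
  split; [apply Hq; lra|].
  apply (ccont_ext (Q (rad z))); [|apply Hq; lra].
  eapply near_imp; [|exact (near_and _ _ _ (near_disk _ _ Hz) (near_disk _ _ Hz1))].
  intros w [Hw Hw2]; destruct (Hrad w Hw) as [Hw3 Hw4]; unfold disk in Hw2.
  apply Huniq; lra || assumption.
Qed.

(* Otherwise [psi - c0] has a continuous square root on the disk, hence so has
   [rho e^(it) - c0] as a function on the circle. *)
Lemma circle_fills psi psi1 rho c0 : 0 < rho ->
  (forall z, disk 1 z -> cder psi z (psi1 z) /\ ccont psi1 z) ->
  (forall u v, disk 1 u -> disk 1 v -> psi u = psi v -> u = v) ->
  (forall w, Cmod w = rho -> exists z, disk 1 z /\ psi z = w) ->
  Cmod c0 < rho -> exists z, disk 1 z /\ psi z = c0.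
Proof.
  intros Hrho Hd Hinj Hcirc Hc0; apply NNPP; intros Hno.
  assert (Hne : forall z, disk 1 z -> (psi z - c0 <> 0)%C).
  { intros z Hz; apply Cminus_neq; intros E; apply Hno; now exists z. }
  destruct (sqrt_disk (fun z => psi z - c0)%C) as (q & Hq).
  { intros z Hz; split; [|now apply Hne].
    apply ccont_minus; [|apply ccont_const]; destruct (Hd z Hz) as [J _]; exact (cder_ccont _ _ _ J). }
  assert (Hch : forall w, exists z, (exists u, disk 1 u /\ psi u = w) -> disk 1 z /\ psi z = w).
  { intros w; destruct (classic (exists u, disk 1 u /\ psi u = w)) as [(u & Hu)|N].
    - now exists u.
    - exists 0%C; tauto. }
  apply (@choice C C) in Hch; destruct Hch as (g & Hg).
  assert (Hgc : forall w, Cmod w = rho -> disk 1 (g w) /\ psi (g w) = w /\ ccont g w).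
  { intros w Hw; destruct (Hcirc w Hw) as (z & Hz & Ez).
    destruct (Hg w (Hcirc w Hw)) as [K1 K2]; split; [exact K1|split; [exact K2|]].
    apply (ccont_inverse psi psi1); auto.
    assert (Hz' : Cmod z < 1) by exact Hz.
    set (r := 1 - Cmod z).
    assert (Hin : forall u, Cmod (u - z)%C < r -> disk 1 u).
    { intros u Hu; unfold disk; pose proof (Cmod_triangle_sub u z); unfold r in Hu; lra. }
    assert (Hr : 0 < r) by (unfold r; lra).
    assert (Hopen := injective_open psi psi1 z r Hr
      (fun u Hu => Hd u (Hin u Hu)) (fun u v Hu Hv => Hinj u v (Hin u Hu) (Hin v Hv)) r Hr).
    rewrite Ez in Hopen; eapply near_imp; [|exact Hopen].
    intros v (u & Hu & Eu); apply Hg; exists u; split; [now apply Hin|exact Eu]. }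
  set (path := fun t => (0 + RtoC rho * cis t)%C).
  assert (Hpath : forall t, Cmod (path t) = rho).
  { intros t; unfold path; replace (0 + RtoC rho * cis t)%C with (RtoC rho * cis t)%C by ring.
    rewrite Cmod_mult, Cmod_cis, Cmod_R, Rabs_pos_eq; lra. }
  assert (Rpath : forall t, rcont path t).
  { intros t; apply (rcont_comp (fun z => 0 + RtoC rho * z)%C cis); [|apply rcont_cis].
    apply ccont_plus; [apply ccont_const|apply ccont_mult; [apply ccont_const|apply ccont_id]]. }
  set (x := fun t => q (g (path t))).
  (* Factoring [path t - c0 = cis t * v t] with [v] in the right half-plane gives the explicit root
     [cis (t / 2) * csqrt (v t)], which changes sign after one turn; the root [x] coming from the
     disk is periodic. *)
  set (v := fun t => (RtoC rho - c0 * Cconj (cis t))%C).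
  set (y := fun t => (cis (t / 2) * csqrt (v t))%C).
  assert (Hv : forall t, 0 < Re (v t)).
  { intros t; pose proof (re_le_Cmod (c0 * Cconj (cis t))%C) as J.
    rewrite Cmod_mult, Cmod_conj, Cmod_cis in J; apply Rabs_le_between in J.
    unfold v, Cminus; rewrite re_plus, re_RtoC.
    replace (Re (- (c0 * Cconj (cis t)))%C) with (- Re (c0 * Cconj (cis t))%C)
      by (unfold Re; simpl; ring); lra. }
  assert (Hcis : forall t, (cis (t / 2) * cis (t / 2) = cis t)%C).
  { intros t; replace t with (2 * (t / 2)) at 3 by field.
    unfold cis; rewrite cos_2a, sin_2a; apply injective_projections; simpl; ring. }
  assert (Hcc : forall t, (cis t * Cconj (cis t) = 1)%C).
  { intros t; rewrite <- Cmod2_conj, Cmod_cis; apply injective_projections; simpl; ring. }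
  assert (Exx : forall t, (x t * x t = path t - c0)%C).
  { intros t; destruct (Hgc _ (Hpath t)) as (K1 & K2 & _); unfold x.
    destruct (Hq _ K1) as [-> _]; now rewrite K2. }
  assert (Eyy : forall t, (y t * y t = path t - c0)%C).
  { intros t; unfold y.
    replace (cis (t / 2) * csqrt (v t) * (cis (t / 2) * csqrt (v t)))%C
      with ((cis (t / 2) * cis (t / 2)) * (csqrt (v t) * csqrt (v t)))%C by ring.
    rewrite Hcis, csqrt_sqr; unfold v, path.
    replace (cis t * (RtoC rho - c0 * Cconj (cis t)))%C
      with (RtoC rho * cis t - c0 * (cis t * Cconj (cis t)))%C by ring.
    rewrite Hcc; ring. }
  assert (Rx : forall t, rcont x t).
  { intros t; destruct (Hgc _ (Hpath t)) as (K1 & _ & K3).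
    apply (rcont_comp (fun w => q (g w)) path); [|apply Rpath].
    apply (ccont_comp q g); [exact K3|now apply Hq]. }
  assert (Ry : forall t, rcont y t).
  { intros t; apply rcont_mult.
    - split; unfold cis; simpl; apply (ex_derive_continuous (V := R_NormedModule));
        auto_derive; auto.
    - apply (rcont_comp csqrt v); [now apply csqrt_ccont|].
      apply (rcont_comp (fun z => RtoC rho - c0 * Cconj z)%C cis); [|apply rcont_cis].
      apply ccont_minus; [apply ccont_const|].
      apply ccont_mult; [apply ccont_const|apply ccont_conj]. }
  assert (Hy0 : forall t, y t <> 0%C).
  { intros t E; pose proof (Eyy t) as K; rewrite E, Cmult_0_l in K.
    destruct (Hgc _ (Hpath t)) as (K1 & K2 & _); apply (Hne _ K1); rewrite K2; now symmetry. }
  pose proof PI_RGT_0 as Hpi.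
  assert (Ex : x (2 * PI) = x 0) by (unfold x, path; now rewrite cis_2PI).
  assert (Ey : y (2 * PI) = (- y 0)%C).
  { unfold y, v; rewrite cis_2PI; replace (2 * PI / 2) with PI by field.
    replace (0 / 2) with 0 by field; unfold cis at 1 3; rewrite cos_PI, sin_PI, cos_0, sin_0.
    set (c := csqrt _); apply injective_projections; simpl; ring. }
  assert (Hcontra : y 0 = (- y 0)%C -> False).
  { intros E; apply (Hy0 0); apply injective_projections;
      [apply (f_equal fst) in E|apply (f_equal snd) in E]; simpl in E |- *; lra. }
  destruct (sqr_eq_cases (x 0) (y 0)) as [E|E]; [now rewrite Exx, Eyy| |].
  - assert (K : x (2 * PI) = y (2 * PI)).
    { apply (sqrt_path_unique x y 0); auto; [lra|]; intros; now rewrite Exx, Eyy. }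
    apply Hcontra; congruence.
  - assert (K : x (2 * PI) = (- y (2 * PI)%R)%C).
    { apply (sqrt_path_unique x (fun t => - y t)%C 0); auto; [lra| | |].
      - intros t _; apply (rcont_comp Copp y); [|apply Ry].
        apply (ccont_opp (fun z => z)), ccont_id.
      - intros t _; rewrite Exx.
        replace (- y t * - y t)%C with (y t * y t)%C by ring; now rewrite Eyy.
      - intros t _ F; apply (Hy0 t); replace (y t) with (- - y t)%C by ring; rewrite F; ring. }
    rewrite Ex, E, Ey in K; apply Hcontra.
    rewrite K at 1; ring.
Qed.

Lemma twice_der_comp f f1 f2 g g1 g2 z :
  twice_der g g1 g2 z -> twice_der f f1 f2 (g z) ->
  twice_der (fun w => f (g w)) (fun w => f1 (g w) * g1 w)%C
    (fun w => f2 (g w) * (g1 w * g1 w) + f1 (g w) * g2 w)%C z.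
Proof.
  intros [G1 G2] [F1 F2]; split.
  - exact (cder_comp f g z _ _ G1 F1).
  - eapply cder_eq; [exact (cder_mult _ _ _ _ _ (cder_comp f1 g z _ _ G1 F2) G2)|].
    cbv beta; ring.
Qed.

Lemma Cmult_Cconj (z : C) : (z * Cconj z)%C = RtoC (Cmod z ^ 2).
Proof. rewrite <- Cmod2_conj; apply injective_projections; simpl; ring. Qed.

(** * Koebe's square root transformation *)

(** The disk automorphism exchanging 0 and [c], for [|c| < 1]. It is an involution, so it also
    serves as its own inverse. *)
Definition mob (c w : C) : C := ((c - w) / (1 - Cconj c * w))%C.
Definition mob1 (c w : C) : C :=
  (- (1 - c * Cconj c) / ((1 - Cconj c * w) * (1 - Cconj c * w)))%C.
Definition mob2 (c w : C) : C :=
  (- (2 * Cconj c * (1 - c * Cconj c)) /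
     ((1 - Cconj c * w) * (1 - Cconj c * w) * (1 - Cconj c * w)))%C.

Lemma one_minus_neq0 (z : C) : Cmod z < 1 -> (1 - z)%C <> 0%C.
Proof.
  intros Hz; apply Cminus_neq; intros E; rewrite <- E, Cmod_1 in Hz; lra.
Qed.

Lemma mob_den c w : disk 1 c -> disk 1 w -> (1 - Cconj c * w)%C <> 0%C.
Proof.
  unfold disk; intros Hc Hw; apply one_minus_neq0; rewrite Cmod_mult, Cmod_conj.
  pose proof (Cmod_ge_0 c); pose proof (Cmod_ge_0 w); nra.
Qed.

(** This is the identity [|1 - conj c w|^2 - |c - w|^2 = (1 - |c|^2) (1 - |w|^2)]. *)
Lemma mob_disk c w : disk 1 c -> disk 1 w -> disk 1 (mob c w).
Proof.
  intros Hc Hw; pose proof (mob_den c w Hc Hw) as Hd; unfold disk in *.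
  unfold mob; rewrite Cmod_div by exact Hd; pose proof (Cmod_pos _ Hd) as Hp.
  apply Rmult_lt_reg_r with (Cmod (1 - Cconj c * w)%C); [exact Hp|].
  unfold Rdiv; rewrite Rmult_assoc, Rinv_l, Rmult_1_r, Rmult_1_l by lra.
  apply Rsqr_incrst_0; [|apply Cmod_ge_0|lra].
  pose proof (Cmod2_alt (c - w)%C) as E1; pose proof (Cmod2_alt (1 - Cconj c * w)%C) as E2.
  pose proof (Cmod2_alt c) as E3; pose proof (Cmod2_alt w) as E4.
  pose proof (Cmod_ge_0 c); pose proof (Cmod_ge_0 w).
  assert (0 < (1 - Cmod c ^ 2) * (1 - Cmod w ^ 2)) by (apply Rmult_lt_0_compat; nra).
  rewrite E3, E4 in H1; unfold Rsqr.
  replace (Cmod (c - w) * Cmod (c - w)) with (Cmod (c - w) ^ 2) by ring.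
  replace (Cmod (1 - Cconj c * w) * Cmod (1 - Cconj c * w)) with (Cmod (1 - Cconj c * w) ^ 2) by ring.
  rewrite E1, E2; unfold Re, Im in *; simpl; nra.
Qed.

Lemma mob_invol c w : disk 1 c -> disk 1 w -> mob c (mob c w) = w.
Proof.
  intros Hc Hw; pose proof (mob_den c w Hc Hw) as Hd.
  pose proof (mob_den c c Hc Hc) as Hcc.
  unfold mob; field; split; [exact Hd|].
  replace (1 - Cconj c * w - Cconj c * (c - w))%C with (1 - Cconj c * c)%C by ring; exact Hcc.
Qed.

Lemma mob_0 c : mob c 0 = c.
Proof. unfold mob; field; apply one_minus_neq0; rewrite Cmult_0_r, Cmod_0; lra. Qed.

Lemma mob_self c : disk 1 c -> mob c c = 0%C.
Proof. intros Hc; unfold mob; field; now apply mob_den. Qed.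

Lemma mob_twice_der c w : disk 1 c -> disk 1 w -> twice_der (mob c) (mob1 c) (mob2 c) w.
Proof.
  intros Hc Hw; pose proof (mob_den c w Hc Hw) as Hd.
  assert (H1 : cder (fun w => 1 - Cconj c * w)%C w (- Cconj c)%C).
  { eapply cder_eq; [apply cder_minus; [apply cder_const|apply cder_mult;
      [apply cder_const|apply cder_id]]|]; cbv beta; ring. }
  split.
  - eapply cder_eq; [apply cder_div; [apply cder_minus; [apply cder_const|apply cder_id]|exact H1|exact Hd]|].
    unfold mob1; cbv beta; field; exact Hd.
  - eapply cder_eq; [apply cder_div; [apply cder_const|apply cder_mult; exact H1|]|].
    + now apply Cmult_neq_0.
    + unfold mob2; cbv beta; field; exact Hd.
Qed.

(** Dividing the Caratheodory factor of [F] by [q w + q z], which stays away from 0 near [z], gives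
    the one of [q]. *)
Lemma sqrt_cder (q F : C -> C) z l :
  near z (fun w => q w * q w = F w)%C -> ccont q z -> F z <> 0%C ->
  cder F z l -> cder q z (l / (2 * q z)).
Proof.
  intros Hn Hq H0 (phi & Hphi & Ephi & HF).
  pose proof (near_self _ _ Hn) as Ez; cbv beta in Ez.
  assert (Hq0 : q z <> 0%C) by (intros E; apply H0; rewrite <- Ez, E; ring).
  assert (H2 : RtoC 2 <> 0%C) by (intros E; apply RtoC_inj in E; lra).
  assert (Hs : ccont (fun w => q w + q z)%C z) by (apply ccont_plus; [exact Hq|apply ccont_const]).
  assert (Hs0 : (q z + q z <> 0)%C).
  { replace (q z + q z)%C with (2 * q z)%C by ring; now apply Cmult_neq_0. }
  exists (fun w => phi w / (q w + q z))%C; repeat split.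
  - now apply ccont_div.
  - rewrite Ephi; replace (q z + q z)%C with (2 * q z)%C by ring; reflexivity.
  - eapply near_imp; [|exact (near_and _ _ _ Hn (near_and _ _ _ HF (ccont_near_neq0 _ _ Hs Hs0)))].
    intros w (E1 & E2 & E3).
    assert (Hw0 : (q w + q z <> 0)%C) by (apply Cmod_gt_0; pose proof (Cmod_pos _ Hs0); lra).
    replace (q w) with (q z + (q w * q w - q z * q z) / (q w + q z))%C at 1 by (field; exact Hw0).
    rewrite E1, Ez, E2; field; exact Hw0.
Qed.

Lemma sqrt_twice_der (q F F1 F2 : C -> C) :
  (forall z, disk 1 z -> twice_der F F1 F2 z) ->
  (forall z, disk 1 z -> F z <> 0%C) ->
  (forall z, disk 1 z -> (q z * q z)%C = F z /\ ccont q z) ->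
  exists q1 q2, forall z, disk 1 z -> twice_der q q1 q2 z.
Proof.
  intros HF H0 Hq.
  set (q1 := fun z => (F1 z / (2 * q z))%C).
  assert (Hd : forall z, disk 1 z -> cder q z (q1 z)).
  { intros z Hz; apply (sqrt_cder q F); [|now apply Hq|now apply H0|now apply HF].
    eapply near_imp; [|exact (near_disk _ _ Hz)]; intros w Hw; now apply Hq. }
  exists q1; eexists; intros z Hz; split; [now apply Hd|].
  apply cder_div; [now apply HF|apply cder_mult; [apply cder_const|now apply Hd]|].
  assert (H2 : RtoC 2 <> 0%C) by (intros E; apply RtoC_inj in E; lra).
  apply Cmult_neq_0; [exact H2|]; intros E; apply (H0 z Hz).
  destruct (Hq z Hz) as [<- _]; rewrite E; ring.
Qed.

Definition self_map (f f1 f2 : C -> C) : Prop :=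
  (forall z, disk 1 z -> twice_der f f1 f2 z) /\ univalent_in_D f /\ f 0%C = 0%C /\
  (forall z, disk 1 z -> disk 1 (f z)).

Lemma disk1_0 : disk 1 0.
Proof. unfold disk; rewrite Cmod_0; lra. Qed.

Lemma twice_der_C1 f f1 f2 :
  (forall z, disk 1 z -> twice_der f f1 f2 z) ->
  forall z, disk 1 z -> cder f z (f1 z) /\ ccont f1 z.
Proof.
  intros Hf z Hz; destruct (Hf z Hz) as [H1 H2]; split; [exact H1|exact (cder_ccont _ _ _ H2)].
Qed.

(* Koebe's square root transformation: if [f] omits [c = b^2] then [f] factors as
   [f = g (lam - g) / (1 - conj lam g)] with [lam = 2 b / (1 + |b|^2)]. *)
Lemma koebe_step f f1 f2 c : self_map f f1 f2 -> disk 1 c ->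
  (forall z, disk 1 z -> f z <> c) ->
  exists (lam : C) (beta : R) (g g1 g2 : C -> C), self_map g g1 g2 /\
    0 <= beta /\ beta * beta = Cmod c /\ Cmod lam = 2 * beta / (1 + beta * beta) /\
    f1 0%C = (lam * g1 0)%C /\
    f2 0%C = (lam * g2 0 - 2 * (g1 0 * g1 0) * (1 - lam * Cconj lam))%C.
Proof.
  intros (Hf & Hinj & Hf0 & Hfd) Hc Hom.
  set (F := fun z => mob c (f z)).
  assert (HFd : forall z, disk 1 z -> disk 1 (F z)) by (intros z Hz; apply mob_disk; auto).
  assert (HF0 : forall z, disk 1 z -> F z <> 0%C).
  { intros z Hz E; apply (Hom z Hz); rewrite <- (mob_invol c (f z)) by auto.
    unfold F in E; rewrite E; apply mob_0. }
  assert (HF : forall z, disk 1 z -> twice_der F (fun w => mob1 c (f w) * f1 w)%C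
    (fun w => mob2 c (f w) * (f1 w * f1 w) + mob1 c (f w) * f2 w)%C z).
  { intros z Hz; exact (twice_der_comp (mob c) (mob1 c) (mob2 c) f f1 f2 z (Hf z Hz)
      (mob_twice_der c (f z) Hc (Hfd z Hz))). }
  destruct (sqrt_disk F) as (q & Hq).
  { intros z Hz; split; [|now apply HF0]; destruct (HF z Hz) as [J _]; exact (cder_ccont _ _ _ J). }
  destruct (sqrt_twice_der q F _ _ HF HF0 Hq) as (q1 & q2 & Hqd).
  assert (Hqdisk : forall z, disk 1 z -> disk 1 (q z)).
  { intros z Hz; destruct (Hq z Hz) as [E _]; specialize (HFd z Hz); unfold disk in *.
    rewrite <- E, Cmod_mult in HFd; pose proof (Cmod_ge_0 (q z)); nra. }
  set (b := q 0%C).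
  assert (Hb : disk 1 b) by (apply Hqdisk, disk1_0).
  assert (Ebc : (b * b)%C = c).
  { unfold b; destruct (Hq 0%C disk1_0) as [-> _]; unfold F; rewrite Hf0; apply mob_0. }
  (* The root takes the value [b] at 0; this automorphism moves it back to the origin. *)
  set (g := fun z => mob b (q z)).
  set (g1 := fun w => (mob1 b (q w) * q1 w)%C).
  set (g2 := fun w => (mob2 b (q w) * (q1 w * q1 w) + mob1 b (q w) * q2 w)%C).
  assert (Hg : forall z, disk 1 z -> twice_der g g1 g2 z).
  { intros z Hz; exact (twice_der_comp (mob b) (mob1 b) (mob2 b) q q1 q2 z (Hqd z Hz)
      (mob_twice_der b (q z) Hb (Hqdisk z Hz))). }
  assert (Hg0 : g 0%C = 0%C) by now apply mob_self.
  assert (Hgd : forall z, disk 1 z -> disk 1 (g z)) by (intros z Hz; apply mob_disk; auto).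
  assert (Hgi : univalent_in_D g).
  { intros z w Hz Hw E; apply Hinj; auto.
    rewrite <- (mob_invol c (f z)), <- (mob_invol c (f w)) by auto.
    fold (F z) (F w); destruct (Hq z Hz) as [<- _]; destruct (Hq w Hw) as [<- _].
    rewrite <- (mob_invol b (q z)), <- (mob_invol b (q w)) by auto.
    fold (g z) (g w); now rewrite E. }
  pose proof (Cmod_ge_0 b) as Hbp.
  assert (Hb1 : (1 + b * Cconj b <> 0)%C).
  { rewrite Cmult_Cconj, <- RtoC_plus; intros E; apply RtoC_inj in E; nra. }
  assert (Hb2 : (1 - Cconj b * b <> 0)%C) by now apply mob_den.
  set (lam := (2 * b / (1 + b * Cconj b))%C).
  assert (Elc : Cconj lam = (2 * Cconj b / (1 + b * Cconj b))%C).
  { unfold lam; rewrite Cmult_Cconj, <- RtoC_plus.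
    replace (2 * b / RtoC (1 + Cmod b ^ 2))%C with (RtoC (2 / (1 + Cmod b ^ 2)) * b)%C.
    - replace (Cconj (RtoC (2 / (1 + Cmod b ^ 2)) * b)) with (RtoC (2 / (1 + Cmod b ^ 2)) * Cconj b)%C
        by (unfold Cconj; destruct b; apply injective_projections; simpl; ring).
      rewrite RtoC_div by nra; field; rewrite RtoC_plus, <- Cmult_Cconj; exact Hb1.
    - rewrite RtoC_div by nra; field; rewrite RtoC_plus, <- Cmult_Cconj; exact Hb1. }
  assert (Hlam : Cmod lam = 2 * Cmod b / (1 + Cmod b * Cmod b)).
  { unfold lam; rewrite Cmod_div by exact Hb1.
    rewrite Cmult_Cconj, <- RtoC_plus, Cmod_mult, !Cmod_R, !Rabs_pos_eq by nra.
    f_equal; ring. }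
  assert (Hid : forall z, disk 1 z -> (f z * (1 - Cconj lam * g z))%C = (g z * (lam - g z))%C).
  { intros z Hz; pose proof (Hgd z Hz) as Ht; set (t := g z) in *.
    assert (Eq : q z = mob b t) by (unfold t, g; now rewrite mob_invol by auto).
    assert (Ef : f z = mob c (q z * q z)).
    { destruct (Hq z Hz) as [-> _]; unfold F; now rewrite mob_invol by auto. }
    assert (Hd1 : (1 - Cconj b * t <> 0)%C) by now apply mob_den.
    assert (Hd2 : (1 - Cconj c * (q z * q z) <> 0)%C).
    { destruct (Hq z Hz) as [-> _]; apply mob_den; auto. }
    set (d := (1 - Cconj b * t)%C) in *.
    assert (Em : (q z * d = b - t)%C) by (rewrite Eq; unfold mob; fold d; field; exact Hd1).
    assert (Ecc : Cconj c = (Cconj b * Cconj b)%C).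
    { rewrite <- Ebc; unfold Cconj; destruct b; apply injective_projections; simpl; ring. }
    assert (Efm : (f z * (1 - Cconj c * (q z * q z)) = c - q z * q z)%C).
    { rewrite Ef; unfold mob; field; exact Hd2. }
    rewrite Ecc, <- Ebc in Efm.
    (* Eliminating [q z] between [Em] and [Efm] leaves a relation between [f z] and [t] with the
       nonzero common factor [1 - |b|^2]. *)
    assert (K : ((1 - Cconj b * b) * (f z * (1 + b * Cconj b - 2 * Cconj b * t)) =
       (1 - Cconj b * b) * (t * (2 * b - (1 + b * Cconj b) * t)))%C).
    { replace ((1 - Cconj b * b) * (f z * (1 + b * Cconj b - 2 * Cconj b * t)))%C
        with (f z * (d * d - Cconj b * Cconj b * ((b - t) * (b - t))))%C by (unfold d; ring).
      replace ((1 - Cconj b * b) * (t * (2 * b - (1 + b * Cconj b) * t)))%C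
        with (b * b * (d * d) - (b - t) * (b - t))%C by (unfold d; ring).
      rewrite <- Em.
      replace (f z * (d * d - Cconj b * Cconj b * (q z * d * (q z * d))))%C
        with (f z * (1 - Cconj b * Cconj b * (q z * q z)) * (d * d))%C by ring.
      rewrite Efm; ring. }
    assert (K2 : (f z * (1 + b * Cconj b - 2 * Cconj b * t) =
       t * (2 * b - (1 + b * Cconj b) * t))%C).
    { apply (f_equal (fun v => v / (1 - Cconj b * b))%C) in K.
      transitivity ((1 - Cconj b * b) * (f z * (1 + b * Cconj b - 2 * Cconj b * t)) / (1 - Cconj b * b))%C;
        [field; exact Hb2|]; rewrite K; field; exact Hb2. }
    rewrite Elc; unfold lam.
    transitivity (f z * (1 + b * Cconj b - 2 * Cconj b * t) / (1 + b * Cconj b))%C;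
      [field; exact Hb1|]; rewrite K2; field; exact Hb1. }
  (* Both derivatives of [f] at 0 come from differentiating the identity [Hid], cleared of
     denominators, once here and once more in [E2], and comparing by [cder_unique]. *)
  assert (Hid1 : forall z, disk 1 z ->
    (f1 z * (1 - Cconj lam * g z) - f z * (Cconj lam * g1 z))%C = (g1 z * (lam - 2 * g z))%C).
  { intros z Hz; destruct (Hf z Hz) as [F1 _]; destruct (Hg z Hz) as [G1 _].
    apply (cder_unique (fun z => g z * (lam - g z))%C z).
    - apply (cder_ext (fun z => f z * (1 - Cconj lam * g z))%C).
      { eapply near_imp; [|exact (near_disk _ _ Hz)]; exact Hid. }
      eapply cder_eq; [apply cder_mult; [exact F1|apply cder_minus; [apply cder_const|
        apply cder_mult; [apply cder_const|exact G1]]]|]; cbv beta; ring.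
    - eapply cder_eq; [apply cder_mult; [exact G1|apply cder_minus; [apply cder_const|exact G1]]|];
        cbv beta; ring. }
  assert (E1 : f1 0%C = (lam * g1 0)%C).
  { pose proof (Hid1 0%C disk1_0) as E; rewrite Hg0, Hf0 in E.
    replace (f1 0%C) with (f1 0 * (1 - Cconj lam * 0) - 0 * (Cconj lam * g1 0))%C by ring.
    rewrite E; ring. }
  exists lam, (Cmod b), g, g1, g2.
  split; [split; [|split; [|split]]; auto|].
  split; [exact Hbp|]. split; [now rewrite <- Cmod_mult, Ebc|]. split; [exact Hlam|].
  split; [exact E1|].
  destruct (Hf 0%C disk1_0) as [F1 F2]; destruct (Hg 0%C disk1_0) as [G1 G2].
  assert (E2 : (f2 0 * (1 - Cconj lam * g 0) - 2 * (f1 0 * (Cconj lam * g1 0)) - f 0 * (Cconj lam * g2 0))%C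
    = (g2 0 * (lam - 2 * g 0) - 2 * (g1 0 * g1 0))%C).
  { apply (cder_unique (fun z => g1 z * (lam - 2 * g z))%C 0%C).
    - apply (cder_ext (fun z => f1 z * (1 - Cconj lam * g z) - f z * (Cconj lam * g1 z))%C).
      { eapply near_imp; [|exact (near_disk _ _ disk1_0)]; exact Hid1. }
      eapply cder_eq; [apply cder_minus; apply cder_mult;
        [exact F2|apply cder_minus; [apply cder_const|apply cder_mult; [apply cder_const|exact G1]]
        |exact F1|apply cder_mult; [apply cder_const|exact G2]]|]; cbv beta; ring.
    - eapply cder_eq; [apply cder_mult; [exact G2|apply cder_minus; [apply cder_const|
        apply cder_mult; [apply cder_const|exact G1]]]|]; cbv beta; ring. }
  rewrite Hg0, Hf0, E1 in E2.
  replace (f2 0%C) with ((f2 0 * (1 - Cconj lam * 0) - 2 * (lam * g1 0 * (Cconj lam * g1 0)) - 0 * (Cconj lam * g2 0))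
    + 2 * (lam * g1 0 * (Cconj lam * g1 0)))%C by ring.
  rewrite E2; ring.
Qed.

(** * Bieberbach's inequality *)

(** This is [2 A f], so the bound aimed at is 4. *)
Definition second_ratio (f1 f2 : C -> C) : R := Cmod (f2 0%C) / Cmod (f1 0%C).

(** Injectivity gives positivity; the upper bound is read off [coefficient_bound], whose left side
    is nonnegative. *)
Lemma self_map_der_pos f f1 f2 : self_map f f1 f2 -> 0 < Cmod (f1 0%C) <= 1.
Proof.
  intros (Hf & Hinj & Hf0 & Hfd); split.
  - apply Cmod_pos, (injective_der_neq0 f f1); auto using disk1_0.
    now apply (twice_der_C1 f f1 f2).
  - assert (H := coefficient_bound f f1 f2 Hf Hf0 (fun z Hz => Rlt_le _ _ (Hfd z Hz))).
    pose proof (Cmod_ge_0 (f2 0 / 2)%C); lra.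
Qed.

(** With [p = |g1 0|], the extra term [2 * p * (1 - lam^2) / lam] factors as
    [2 * (1 + / lam) * (p - lam * p)]. Written as an increment of the first derivative, it
    telescopes over repeated steps. *)
Lemma koebe_step_ratio f f1 f2 beta c : self_map f f1 f2 -> 0 < beta < 1 ->
  Cmod c = beta * beta -> (forall z, disk 1 z -> f z <> c) ->
  let lam := 2 * beta / (1 + beta * beta) in
  exists g g1 g2, self_map g g1 g2 /\ Cmod (f1 0%C) = lam * Cmod (g1 0%C) /\
    second_ratio f1 f2 <=
      second_ratio g1 g2 + 2 * (1 + / lam) * (Cmod (g1 0%C) - Cmod (f1 0%C)).
Proof.
  intros Hf Hbeta Ec Hom lam.
  destruct (koebe_step f f1 f2 c Hf) as (l & b' & g & g1 & g2 & Hg & Hb' & Eb' & El & E1 & E2); auto.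
  { unfold disk; nra. }
  assert (b' = beta) by nra; subst b'.
  fold lam in El.
  assert (Hlam : 0 < lam) by (apply Rdiv_lt_0_compat; nra).
  assert (Hlam1 : lam < 1).
  { unfold lam; apply Rmult_lt_reg_r with (1 + beta * beta); [nra|].
    unfold Rdiv; rewrite Rmult_assoc, Rinv_l by nra; nra. }
  pose proof (self_map_der_pos _ _ _ Hf) as Hp; pose proof (self_map_der_pos _ _ _ Hg) as Hp'.
  exists g, g1, g2; split; [exact Hg|].
  assert (Ep : Cmod (f1 0%C) = lam * Cmod (g1 0%C)) by now rewrite E1, Cmod_mult, El.
  split; [exact Ep|]; unfold second_ratio; rewrite Ep.
  set (p := Cmod (g1 0%C)) in *.
  assert (HB : Cmod (f2 0%C) <= lam * Cmod (g2 0%C) + 2 * (p * p) * (1 - lam * lam)).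
  { rewrite E2; eapply Rle_trans; [apply Cmod_sub_le|].
    rewrite !Cmod_mult, El, (Cmod_R 2), (Rabs_pos_eq 2) by lra; fold p.
    replace (1 - l * Cconj l)%C with (RtoC (1 - lam * lam)).
    - rewrite Cmod_R, Rabs_pos_eq by nra; lra.
    - rewrite Cmult_Cconj, El, <- RtoC_minus; f_equal; ring. }
  apply Rmult_le_reg_r with (lam * p); [nra|].
  replace (Cmod (f2 0%C) / (lam * p) * (lam * p)) with (Cmod (f2 0%C)) by (field; lra).
  eapply Rle_trans; [exact HB|]; right; field; lra.
Qed.

(* Take [x] close to the largest derivative reachable from [f] by square root
   steps through points of the circle [|w| = beta^2]: then the map reached covers
   that circle, hence the disk, so its derivative is at least [beta^2]. *)
Lemma self_map_ratio_beta f f1 f2 beta : self_map f f1 f2 -> 0 < beta < 1 ->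
  second_ratio f1 f2 <= 4 * (1 - beta * beta) / (beta * beta) + 2 * (1 + (1 + beta * beta) / (2 * beta)).
Proof.
  intros Hf Hbeta.
  set (lam := 2 * beta / (1 + beta * beta)).
  set (p := Cmod (f1 0%C)).
  assert (Hlam : 0 < lam) by (apply Rdiv_lt_0_compat; nra).
  assert (Hlam1 : lam < 1).
  { unfold lam; apply Rmult_lt_reg_r with (1 + beta * beta); [nra|].
    unfold Rdiv; rewrite Rmult_assoc, Rinv_l by nra; nra. }
  assert (Einv : / lam = (1 + beta * beta) / (2 * beta)) by (unfold lam; field; nra).
  rewrite <- Einv.
  (* The telescoped estimate is part of membership, so it comes with any element chosen near the
     supremum and no steps have to be counted. *)
  set (E := fun x => exists g g1 g2, self_map g g1 g2 /\ Cmod (g1 0%C) = x /\ p <= x /\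
    second_ratio f1 f2 <= second_ratio g1 g2 + 2 * (1 + / lam) * (x - p)).
  pose proof (self_map_der_pos _ _ _ Hf) as Hp; fold p in Hp.
  assert (HEp : E p).
  { exists f, f1, f2; split; [exact Hf|]; split; [reflexivity|]; split; lra. }
  destruct (completeness E) as [P [HPub HPlub]].
  { exists 1; intros x (g & g1 & g2 & Hg & <- & _); apply (self_map_der_pos _ _ _ Hg). }
  { now exists p. }
  assert (HPp : p <= P) by now apply HPub.
  (* For this [x], one more square root step would put [x / lam > P] into [E], so the map reached
     omits no point of the circle. *)
  assert (Hx : exists x, E x /\ lam * P < x).
  { apply NNPP; intros N; assert (HP : P <= lam * P); [|nra].
    apply HPlub; intros x Hx; apply Rnot_lt_le; intros Hlt; apply N; now exists x. }
  destruct Hx as (x & (g & g1 & g2 & Hg & Ex & Hpx & Hratio) & Hx).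
  pose proof (Rinv_0_lt_compat _ Hlam) as Hil.
  assert (Hcirc : forall c, Cmod c = beta * beta -> exists z, disk 1 z /\ g z = c).
  { intros c Hc; apply NNPP; intros N.
    destruct (koebe_step_ratio g g1 g2 beta c Hg Hbeta Hc) as (k & k1 & k2 & Hk & Ek & Hkr).
    { intros z Hz Ez; apply N; now exists z. }
    fold lam in Ek, Hkr; rewrite Ex in Ek, Hkr.
    pose proof (self_map_der_pos _ _ _ Hk) as Hkp.
    assert (Hin : E (Cmod (k1 0%C))).
    { exists k, k1, k2; split; [exact Hk|]; split; [reflexivity|]; split; nra. }
    apply HPub in Hin; nra. }
  destruct Hg as (Hgd & Hgi & Hg0 & Hgdisk).
  assert (Hb2 : 0 < beta * beta) by nra.
  assert (Hrad : beta * beta <= x).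
  { rewrite <- Ex; apply (inner_radius_le_der g g1); auto.
    - now apply (twice_der_C1 g g1 g2).
    - intros w Hw; apply (circle_fills g g1 (beta * beta)); auto.
      now apply (twice_der_C1 g g1 g2). }
  assert (Hco := coefficient_bound g g1 g2 Hgd Hg0 (fun z Hz => Rlt_le _ _ (Hgdisk z Hz))).
  rewrite Ex in Hco.
  assert (H2 : RtoC 2 <> 0%C) by (intros F; apply RtoC_inj in F; lra).
  rewrite Cmod_div, Cmod_R, Rabs_pos_eq in Hco by (exact H2 || lra).
  assert (Hgr : second_ratio g1 g2 <= 4 * (1 - beta * beta) / (beta * beta)).
  { unfold second_ratio; rewrite Ex; pose proof (Cmod_ge_0 (g2 0%C)).
    apply Rle_trans with (4 * (1 - x) / x).
    - apply Rmult_le_compat_r; [left; apply Rinv_0_lt_compat|]; lra.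
    - pose proof (Rinv_0_lt_compat x ltac:(lra)).
      pose proof (Rinv_le_contravar (beta * beta) x Hb2 Hrad).
      unfold Rdiv; apply Rmult_le_compat; lra. }
  assert (x <= 1).
  { rewrite <- Ex; apply (self_map_der_pos g g1 g2); repeat split; auto; now apply Hgd. }
  assert (2 * (1 + / lam) * (x - p) <= 2 * (1 + / lam) * 1) by (apply Rmult_le_compat_l; lra).
  lra.
Qed.

(** As [beta] tends to 1 the first term of [self_map_ratio_beta] vanishes and the second tends to
    4. *)
Lemma self_map_second_coefficient f f1 f2 : self_map f f1 f2 ->
  Cmod (f2 0%C) <= 4 * Cmod (f1 0%C).
Proof.
  intros Hf; pose proof (self_map_der_pos _ _ _ Hf) as Hp.
  assert (Hr : second_ratio f1 f2 <= 4).
  { apply Rnot_lt_le; intros Hlt.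
    set (X := second_ratio f1 f2) in *.
    (* The bound for [beta = 1 - e] is at most [32 * e + 2 * (2 + e) = 4 + 34 * e], hence at most
       the midpoint of 4 and [X]. *)
    set (e := Rmin (1 / 2) ((X - 4) / 68)).
    assert (He0 : 0 < e) by (apply Rmin_glb_lt; lra).
    assert (He1 : e <= 1 / 2) by apply Rmin_l.
    assert (He2 : e <= (X - 4) / 68) by apply Rmin_r.
    pose proof (self_map_ratio_beta f f1 f2 (1 - e) Hf ltac:(lra)) as H; fold X in H.
    assert (A1 : 4 * (1 - (1 - e) * (1 - e)) / ((1 - e) * (1 - e)) <= 32 * e).
    { apply Rmult_le_reg_r with ((1 - e) * (1 - e)); [nra|].
      unfold Rdiv; rewrite Rmult_assoc, Rinv_l by nra; nra. }
    assert (A2 : (1 + (1 - e) * (1 - e)) / (2 * (1 - e)) <= 1 + e).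
    { apply Rmult_le_reg_r with (2 * (1 - e)); [nra|].
      unfold Rdiv; rewrite Rmult_assoc, Rinv_l by nra; nra. }
    lra. }
  unfold second_ratio in Hr.
  apply Rmult_le_compat_r with (r := Cmod (f1 0%C)) in Hr; [|lra].
  unfold Rdiv in Hr; rewrite Rmult_assoc, Rinv_l in Hr; lra.
Qed.

(** A dilation [f (s z)] is bounded, and dividing it by a bound makes it a self-map of the disk
    without affecting the ratio of its derivatives; then [s] tends to 1. *)
Lemma bieberbach f f1 f2 :
  (forall z, disk 1 z -> twice_der f f1 f2 z) -> univalent_in_D f -> f 0%C = 0%C ->
  Cmod (f2 0%C) <= 4 * Cmod (f1 0%C).
Proof.
  intros Hf Hinj H0.
  assert (Hs : forall s, 0 < s < 1 -> s * Cmod (f2 0%C) <= 4 * Cmod (f1 0%C)).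
  { intros s Hs.
    destruct (disk_bounded f s) as (M & HM & HB).
    { intros z Hz; destruct (Hf z) as [J _]; [unfold disk; lra|exact (cder_ccont _ _ _ J)]. }
    set (k := RtoC (/ (M + 1))).
    assert (Hk : Cmod k = / (M + 1)).
    { unfold k; rewrite Cmod_R, Rabs_pos_eq; [reflexivity|]; left; apply Rinv_0_lt_compat; lra. }
    assert (Hkp : 0 < Cmod k) by (rewrite Hk; apply Rinv_0_lt_compat; lra).
    assert (Hsd : forall z, disk 1 z -> Cmod (RtoC s * z)%C <= s).
    { intros z Hz; unfold disk in Hz; rewrite Cmod_mult, Cmod_R, Rabs_pos_eq by lra.
      pose proof (Cmod_ge_0 z); nra. }
    assert (Hsd1 : forall z, disk 1 z -> disk 1 (RtoC s * z)%C).
    { intros z Hz; specialize (Hsd z Hz); unfold disk; lra. }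
    assert (HS : self_map (fun z => k * f (RtoC s * z))%C (fun z => k * s * f1 (RtoC s * z))%C
      (fun z => k * s * s * f2 (RtoC s * z))%C).
    { repeat split.
      - destruct (Hf _ (Hsd1 z H)) as [J _].
        assert (L : cder (fun z => RtoC s * z)%C z (RtoC s)).
        { eapply cder_eq; [apply cder_mult; [apply cder_const|apply cder_id]|]; cbv beta; ring. }
        eapply cder_eq; [apply cder_mult; [apply cder_const|
          exact (cder_comp f (fun z => RtoC s * z)%C z _ _ L J)]|]; cbv beta; ring.
      - destruct (Hf _ (Hsd1 z H)) as [_ J].
        assert (L : cder (fun z => RtoC s * z)%C z (RtoC s)).
        { eapply cder_eq; [apply cder_mult; [apply cder_const|apply cder_id]|]; cbv beta; ring. }
        eapply cder_eq; [apply cder_mult; [apply cder_const|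
          exact (cder_comp f1 (fun z => RtoC s * z)%C z _ _ L J)]|]; cbv beta; ring.
      - intros z w Hz Hw E.
        apply Cmod_pos_neq in Hkp.
        assert (E2 : f (RtoC s * z)%C = f (RtoC s * w)%C).
        { replace (f (RtoC s * z)%C) with (k * f (RtoC s * z) / k)%C by (field; exact Hkp).
          rewrite E; field; exact Hkp. }
        apply Hinj in E2; [|now apply Hsd1|now apply Hsd1].
        assert (Hs0 : RtoC s <> 0%C) by (intros F; apply RtoC_inj in F; lra).
        replace z with (RtoC s * z / s)%C by (field; exact Hs0); rewrite E2; field; exact Hs0.
      - rewrite Cmult_0_r, H0; ring.
      - intros z Hz; unfold disk; rewrite Cmod_mult, Hk.
        specialize (HB _ (Hsd z Hz)).
        apply Rmult_lt_reg_l with (M + 1); [lra|].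
        rewrite <- Rmult_assoc, Rinv_r; lra. }
    apply self_map_second_coefficient in HS.
    rewrite Cmult_0_r, !Cmod_mult, Cmod_R, Rabs_pos_eq in HS by lra.
    apply Rmult_le_reg_l with (Cmod k * s); [nra|]; lra. }
  apply Rnot_lt_le; intros Hlt.
  set (a := Cmod (f2 0%C)) in *; set (b := Cmod (f1 0%C)) in *.
  assert (Hb : 0 <= b) by apply Cmod_ge_0.
  assert (Ha : 0 < a) by lra.
  (* This choice gives [s * a = (a + 4 * b) / 2], still larger than [4 * b]. *)
  set (s := 1 - (a - 4 * b) / (2 * a)).
  assert (Hq : (a - 4 * b) / (2 * a) * a = (a - 4 * b) / 2) by (field; lra).
  assert (Hq0 : 0 < (a - 4 * b) / (2 * a)) by (apply Rdiv_lt_0_compat; lra).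
  specialize (Hs s ltac:(unfold s; split; nra)).
  unfold s in Hs; lra.
Qed.

(** [bieberbach] is homogeneous, so it is applied to [h (mob a z) - h a] without dividing by the
    derivative at 0. At 0 the map [mob a] has derivatives [-(1 - |a|^2)] and
    [-2 conj a (1 - |a|^2)]. *)
Lemma pre_schwarzian_bound h h1 h2 a :
  (forall z, disk 1 z -> twice_der h h1 h2 z) -> univalent_in_D h -> disk 1 a ->
  Cmod (RtoC (1 - Cmod a ^ 2) * h2 a - 2 * Cconj a * h1 a)%C <= 4 * Cmod (h1 a).
Proof.
  intros Hh Hinj Ha.
  assert (H := bieberbach (fun z => h (mob a z) - h a)%C (fun z => h1 (mob a z) * mob1 a z)%C
    (fun z => h2 (mob a z) * (mob1 a z * mob1 a z) + h1 (mob a z) * mob2 a z)%C).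
  cbv beta in H; rewrite mob_0 in H.
  assert (Ha' : Cmod a < 1) by exact Ha; pose proof (Cmod_ge_0 a).
  set (k := 1 - Cmod a ^ 2) in *.
  assert (Hk : 0 < k) by (unfold k; nra).
  assert (Ek : (1 - a * Cconj a)%C = RtoC k) by (unfold k; rewrite Cmult_Cconj, RtoC_minus; ring).
  assert (E1 : mob1 a 0 = (- RtoC k)%C).
  { unfold mob1; rewrite Ek; field. }
  assert (E2 : mob2 a 0 = (- (2 * Cconj a * RtoC k))%C).
  { unfold mob2; rewrite Ek; field. }
  rewrite E1, E2 in H.
  replace (h2 a * (- RtoC k * - RtoC k) + h1 a * - (2 * Cconj a * RtoC k))%C
    with (RtoC k * (RtoC k * h2 a - 2 * Cconj a * h1 a))%C in H by ring.
  rewrite !Cmod_mult, Cmod_opp, Cmod_R, Rabs_pos_eq in H by lra.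
  apply Rmult_le_reg_l with k; [exact Hk|].
  replace (k * (4 * Cmod (h1 a))) with (4 * (Cmod (h1 a) * k)) by ring; apply H.
  - intros z Hz; pose proof (twice_der_comp h h1 h2 (mob a) (mob1 a) (mob2 a) z
      (mob_twice_der a z Ha Hz) (Hh _ (mob_disk a z Ha Hz))) as [J1 J2]; split; [|exact J2].
    eapply cder_eq; [apply cder_minus; [exact J1|apply cder_const]|]; ring.
  - intros z w Hz Hw E; rewrite <- (mob_invol a z), <- (mob_invol a w) by auto; f_equal.
    apply Hinj; auto using mob_disk.
    replace (h (mob a z)) with ((h (mob a z) - h a) + h a)%C by ring; rewrite E; ring.
  - ring.
Qed.

(** * The Jacobian *)

Lemma is_derive_C (g : R -> C) t (l : C) :
  is_derive (fun u => Re (g u)) t (Re l) -> is_derive (fun u => Im (g u)) t (Im l) ->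
  @is_derive R_AbsRing C_R_NormedModule g t l.
Proof.
  intros H1 H2.
  apply (is_derive_ext (V := C_R_NormedModule) (fun u => (Re (g u), Im (g u)))).
  { intros u; now destruct (g u). }
  replace l with (Re l, Im l) by now destruct l.
  apply (filterdiff_comp_2 (W := C_R_NormedModule) (fun u => Re (g u)) (fun u => Im (g u))
    (fun x y => (x, y)) (fun y => scal y (Re l)) (fun y => scal y (Im l)) (fun x y => (x, y)) H1 H2).
  apply filterdiff_linear; split; [reflexivity|reflexivity|].
  exists 1; split; [lra|]; intros [x y]; rewrite Rmult_1_l; apply Rle_refl.
Qed.

Lemma ccont_continuous f z : ccont f z -> @continuous C_UniformSpace C_UniformSpace f z.
Proof.
  intros Hf P [e He].
  assert (H1 : filterlim (fun w : C => fst w) (@locally C_UniformSpace z) (locally (fst z))).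
  { intros Q [d Hd]; exists d; intros w [Hw _]; now apply Hd. }
  assert (H2 : filterlim (fun w : C => snd w) (@locally C_UniformSpace z) (locally (snd z))).
  { intros Q [d Hd]; exists d; intros w [_ Hw]; now apply Hd. }
  assert (H := near_filter (@locally C_UniformSpace z) (fun w : C => w) z _ H1 H2 (Hf e (cond_pos e))).
  unfold filtermap; revert H; apply filter_imp; intros w Hw; apply He.
  apply C_NormedModule_mixin_compat1; exact Hw.
Qed.

Section Jacobian.
Variables h h1 h2 : C -> C.
Hypothesis Hh : forall z, disk 1 z -> twice_der h h1 h2 z.

Let u := fun z : C => (h z + RtoC (/2 * (1 - Cmod z ^ 2)) * z * h1 z)%C.

(* [Re (conj z v)] is written as [(conj z v + z conj v) / 2]. *)
Definition dir_der (v z : C) : C :=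
  (h1 z * v + (1 - z * Cconj z) / 2 * ((h1 z + z * h2 z) * v)
   - (Cconj z * v + z * Cconj v) / 2 * (z * h1 z))%C.

Lemma dir_der_spec v z : disk 1 z ->
  @is_derive R_AbsRing C_R_NormedModule (fun t : R => u (z + RtoC t * v)%C) 0 (dir_der v z).
Proof.
  intros Hz; destruct (Hh z Hz) as [J1 J2].
  set (g := fun t : R => (z + RtoC t * v)%C).
  assert (G0 : g 0 = z) by (unfold g; ring).
  assert (g1 : is_derive (fun t => fst (g t)) 0 (fst v)).
  { apply is_derive_ext with (fun t => fst z + t * fst v); [intros; unfold g; simpl; ring|].
    auto_derive; auto; ring. }
  assert (g2 : is_derive (fun t => snd (g t)) 0 (snd v)).
  { apply is_derive_ext with (fun t => snd z + t * snd v); [intros; unfold g; simpl; ring|].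
    auto_derive; auto; ring. }
  assert (K : cder (fun w => w * h1 w)%C z (h1 z + z * h2 z)%C).
  { eapply cder_eq; [apply cder_mult; [apply cder_id|exact J2]|]; cbv beta; ring. }
  (* The nonholomorphic factor of [u] is isolated as a real function of [t], so that the real
     product rule applies to each coordinate. *)
  set (rho := fun t : R => /2 * (1 - ((fst z + t * fst v) ^ 2 + (snd z + t * snd v) ^ 2))).
  assert (Erho : forall t, /2 * (1 - Cmod (g t) ^ 2) = rho t).
  { intros t; rewrite Cmod2_alt; unfold rho, g, Re, Im; simpl; ring. }
  assert (Hrho : is_derive rho 0 (- (fst z * fst v + snd z * snd v))).
  { unfold rho; auto_derive; auto; field. }
  assert (Er0 : RtoC (rho 0) = ((1 - z * Cconj z) / 2)%C).
  { unfold rho; destruct z; apply injective_projections; simpl; field. }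
  assert (Er1 : RtoC (- (fst z * fst v + snd z * snd v)) = (- ((Cconj z * v + z * Cconj v) / 2))%C).
  { destruct z, v; apply injective_projections; simpl; field. }
  assert (Ed : dir_der v z = (h1 z * v + (RtoC (rho 0) * ((h1 z + z * h2 z) * v)
     + RtoC (- (fst z * fst v + snd z * snd v)) * (z * h1 z)))%C).
  { rewrite Er0, Er1; unfold dir_der; ring. }
  rewrite Ed; apply is_derive_C.
  - apply is_derive_ext with (fun t => Re (h (g t)) + rho t * Re (g t * h1 (g t))%C).
    { intros t; unfold u; fold (g t); rewrite re_plus, Erho, <- Cmult_assoc, re_scal_l; reflexivity. }
    rewrite !re_plus, !re_scal_l.
    apply (is_derive_plus (V := R_NormedModule)).
    + replace v with (fst v, snd v) by now destruct v.
      apply (cder_curve_re h g); auto; now rewrite G0.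
    + replace (rho 0 * Re ((h1 z + z * h2 z) * v)%C + - (fst z * fst v + snd z * snd v) * Re (z * h1 z)%C)
        with (- (fst z * fst v + snd z * snd v) * Re (g 0 * h1 (g 0))%C
          + rho 0 * Re ((h1 z + z * h2 z) * v)%C) by (rewrite G0; ring).
      apply (is_derive_mult rho (fun t => Re (g t * h1 (g t))%C) 0); [exact Hrho| |intros; apply Rmult_comm].
      replace v with (fst v, snd v) by now destruct v.
      apply (cder_curve_re (fun w => w * h1 w)%C g); auto; now rewrite G0.
  - apply is_derive_ext with (fun t => Im (h (g t)) + rho t * Im (g t * h1 (g t))%C).
    { intros t; unfold u; fold (g t); rewrite im_plus, Erho, <- Cmult_assoc, im_scal_l; reflexivity. }
    rewrite !im_plus, !im_scal_l.
    apply (is_derive_plus (V := R_NormedModule)).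
    + replace v with (fst v, snd v) by now destruct v.
      apply (cder_curve_im h g); auto; now rewrite G0.
    + replace (rho 0 * Im ((h1 z + z * h2 z) * v)%C + - (fst z * fst v + snd z * snd v) * Im (z * h1 z)%C)
        with (- (fst z * fst v + snd z * snd v) * Im (g 0 * h1 (g 0))%C
          + rho 0 * Im ((h1 z + z * h2 z) * v)%C) by (rewrite G0; ring).
      apply (is_derive_mult rho (fun t => Im (g t * h1 (g t))%C) 0); [exact Hrho| |intros; apply Rmult_comm].
      replace v with (fst v, snd v) by now destruct v.
      apply (cder_curve_im (fun w => w * h1 w)%C g); auto; now rewrite G0.
Qed.

(** The partial derivatives of [u] contain [h2], so their continuity draws on [second_der_ccont]. *)
Lemma dir_der_ccont v z : disk 1 z -> ccont (dir_der v) z.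
Proof.
  intros Hz; destruct (Hh z Hz) as [J1 J2].
  pose proof (cder_ccont _ _ _ J2); pose proof (second_der_ccont h h1 h2 Hh z Hz).
  assert (H2 : RtoC 2 <> 0%C) by (intros E; apply RtoC_inj in E; lra).
  unfold dir_der.
  repeat first [apply ccont_minus | apply ccont_plus | apply ccont_mult | apply ccont_div
    | apply ccont_const | apply ccont_id | apply ccont_conj | assumption].
Qed.

Lemma mapping_ccont z : disk 1 z -> ccont u z.
Proof.
  intros Hz; destruct (Hh z Hz) as [J1 J2].
  pose proof (cder_ccont _ _ _ J1); pose proof (cder_ccont _ _ _ J2).
  assert (H2 : RtoC 2 <> 0%C) by (intros E; apply RtoC_inj in E; lra).
  apply (ccont_ext (fun w => h w + (1 - w * Cconj w) / 2 * w * h1 w)%C).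
  - exists 1; split; [lra|]; intros w _; unfold u; rewrite Cmult_Cconj.
    replace (RtoC (/ 2 * (1 - Cmod w ^ 2))) with ((1 - RtoC (Cmod w ^ 2)) / 2)%C; [ring|].
    apply injective_projections; simpl; field.
  - repeat first [apply ccont_minus | apply ccont_plus | apply ccont_mult | apply ccont_div
      | apply ccont_const | apply ccont_id | apply ccont_conj | assumption].
Qed.

(** The threshold -2 is exactly where the lower bound [1 - r2 + (1 - r2) / 2 * Re P + r2 / 2] for
    [|u_z| / |h1 z|] falls to [r2 / 2], the value of [|u_zbar| / |h1 z|]. *)
Lemma jacobian_pos z : disk 1 z -> h1 z <> 0%C -> Re (1 + z * h2 z / h1 z)%C > -2 ->
  jacobian (dir_der 1 z) (dir_der Ci z) > 0.
Proof.
  intros Hz H0 HRe.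
  assert (Hz' : Cmod z < 1) by exact Hz; pose proof (Cmod_ge_0 z).
  set (P := (1 + z * h2 z / h1 z)%C) in *.
  set (r2 := Cmod z ^ 2).
  assert (Hr2 : 0 <= r2 < 1) by (unfold r2; nra).
  assert (ECi : (Ci * Ci = - (1))%C) by (apply injective_projections; simpl; ring).
  assert (Ezz : (z * Cconj z)%C = RtoC r2) by apply Cmult_Cconj.
  assert (C1 : Cconj 1 = 1%C) by (apply injective_projections; simpl; ring).
  assert (CCi : Cconj Ci = (- Ci)%C) by (apply injective_projections; simpl; ring).
  assert (E1 : ((dir_der 1 z - Ci * dir_der Ci z) / 2 =
     h1 z * (1 - RtoC r2 + (1 - RtoC r2) / 2 * P + RtoC r2 / 2))%C).
  { unfold dir_der, P; rewrite C1, CCi, <- Ezz.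
    (* All occurrences of [Ci] are collected into [Ci * Ci], since the field identities do not know
       that this is [-1]. *)
    transitivity ((h1 z * (1 - Ci * Ci) + (1 - z * Cconj z) / 2 * ((h1 z + z * h2 z) * (1 - Ci * Ci))
      - ((Cconj z + z) - (Ci * Ci) * (Cconj z - z)) / 2 * (z * h1 z)) / 2)%C; [field|].
    rewrite ECi; field; exact H0. }
  assert (E2 : ((dir_der 1 z + Ci * dir_der Ci z) / 2 = - (h1 z * (z * z) / 2))%C).
  { unfold dir_der; rewrite C1, CCi.
    transitivity ((h1 z * (1 + Ci * Ci) + (1 - z * Cconj z) / 2 * ((h1 z + z * h2 z) * (1 + Ci * Ci))
      - ((Cconj z + z) + (Ci * Ci) * (Cconj z - z)) / 2 * (z * h1 z)) / 2)%C; [field|].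
    rewrite ECi; field. }
  unfold jacobian; rewrite E1, E2.
  assert (H2 : RtoC 2 <> 0%C) by (intros E; apply RtoC_inj in E; lra).
  rewrite Cmod_opp, Cmod_div, !Cmod_mult, (Cmod_R 2), (Rabs_pos_eq 2) by (exact H2 || lra).
  pose proof (Cmod_pos _ H0) as Hp.
  set (w := (1 - RtoC r2 + (1 - RtoC r2) / 2 * P + RtoC r2 / 2)%C).
  assert (Hw : r2 / 2 < Cmod w).
  { apply Rlt_le_trans with (Re w); [|eapply Rle_trans; [apply Rle_abs|apply re_le_Cmod]].
    replace (Re w) with (1 - r2 + (1 - r2) / 2 * Re P + r2 / 2).
    - nra.
    - unfold w; replace ((1 - RtoC r2) / 2)%C with (RtoC ((1 - r2) / 2)).
      + replace (1 - RtoC r2 + RtoC ((1 - r2) / 2) * P + RtoC r2 / 2)%C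
          with (RtoC (1 - r2 + r2 / 2) + RtoC ((1 - r2) / 2) * P)%C.
        * rewrite re_plus, re_scal_l, re_RtoC; ring.
        * rewrite RtoC_plus, RtoC_minus, (RtoC_div r2) by lra; ring.
      + rewrite RtoC_div, RtoC_minus by lra; reflexivity. }
  replace (Cmod (h1 z) * (Cmod z * Cmod z) / 2) with (Cmod (h1 z) * (r2 / 2)) by (unfold r2; field).
  rewrite !Rpow_mult_distr.
  assert (0 < Cmod (h1 z) ^ 2) by nra.
  assert ((r2 / 2) ^ 2 < Cmod w ^ 2) by nra.
  nra.
Qed.

Lemma sense_preserving_of_Re (Omega : C -> Prop) :
  (forall z, Omega z -> disk 1 z /\ h1 z <> 0%C /\ Re (1 + z * h2 z / h1 z)%C > -2) ->
  sense_preserving Omega u.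
Proof.
  intros HO; exists (dir_der 1), (dir_der Ci); intros z Hz.
  destruct (HO z Hz) as (Hd & H0 & HRe).
  split; [|split; [now apply dir_der_spec|split; [|split; [|split]]]].
  - apply (is_derive_ext (V := C_R_NormedModule) (fun t : R => u (z + RtoC t * 1)%C));
      [intros t; now rewrite Cmult_1_r|now apply dir_der_spec].
  - now apply ccont_continuous, mapping_ccont.
  - now apply ccont_continuous, dir_der_ccont.
  - now apply ccont_continuous, dir_der_ccont.
  - now apply jacobian_pos.
Qed.

Lemma univalent_Re_bound z : univalent_in_D h -> disk (sqrt 7 - 2) z ->
  disk 1 z /\ h1 z <> 0%C /\ Re (1 + z * h2 z / h1 z)%C > -2.
Proof.
  intros Hinj Hz; unfold disk in Hz.
  pose proof (sqrt_sqrt 7 ltac:(lra)) as H7; pose proof (sqrt_pos 7) as Hs.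
  pose proof (Cmod_ge_0 z) as Hr.
  assert (Hz1 : Cmod z < 1) by nra.
  assert (Hd : disk 1 z) by exact Hz1.
  assert (H0 : h1 z <> 0%C).
  { apply (injective_der_neq0 h h1); auto; now apply (twice_der_C1 h h1 h2). }
  split; [exact Hd|]; split; [exact H0|].
  pose proof (pre_schwarzian_bound h h1 h2 z Hh Hinj Hd) as HB.
  set (k := 1 - Cmod z ^ 2) in *.
  assert (Hk : 0 < k) by (unfold k; nra).
  set (P := (z * h2 z / h1 z)%C).
  assert (HP : Cmod (RtoC k * P - RtoC (2 * Cmod z ^ 2))%C <= 4 * Cmod z).
  { replace (RtoC k * P - RtoC (2 * Cmod z ^ 2))%C
      with (z / h1 z * (RtoC k * h2 z - 2 * Cconj z * h1 z))%C.
    - rewrite Cmod_mult, Cmod_div by exact H0; pose proof (Cmod_pos _ H0) as Hp.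
      apply Rle_trans with (Cmod z / Cmod (h1 z) * (4 * Cmod (h1 z))).
      + apply Rmult_le_compat_l; [apply Rdiv_le_0_compat|]; assumption.
      + right; field; lra.
    - rewrite RtoC_mult, <- Cmult_Cconj; unfold P; field; exact H0. }
  pose proof (Rle_trans _ _ _ (re_le_Cmod _) HP) as HR; apply Rabs_le_between in HR.
  unfold Cminus in HR; rewrite re_plus, re_scal_l in HR.
  replace (Re (- RtoC (2 * Cmod z ^ 2))%C) with (- (2 * Cmod z ^ 2)) in HR by (simpl; ring).
  rewrite re_plus; simpl (Re 1).
  apply Rlt_gt, Rmult_lt_reg_l with k; [exact Hk|].
  (* With [r = |z|], [HR] gives [k * Re P >= 2 r^2 - 4 r], and [3 k + 2 r^2 - 4 r = 3 - 4 r - r^2];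
     the positive root of this quadratic is [sqrt 7 - 2]. *)
  assert (0 < 3 - 4 * Cmod z - Cmod z ^ 2) by nra.
  unfold k in *; nra.
Qed.

End Jacobian.

(** * The three sufficient conditions *)

Theorem theorem1 (h h1 h2 : C -> C) :
  analytic_in_D h ->
  (forall z, disk 1 z -> cderiv h z (h1 z)) ->
  (forall z, disk 1 z -> cderiv h1 z (h2 z)) ->
  h 0%C = 0%C -> h1 0%C = 1%C ->
  let u := fun z : C => (h z + RtoC (/2 * (1 - Cmod z ^ 2)) * z * h1 z)%C in
  (convex_of_order 0 h1 h2 -> sense_preserving (disk 1) u) /\
  (forall alpha : R, -1/2 <= alpha < 0 ->
     convex_of_order alpha h1 h2 -> sense_preserving (disk 1) u) /\
  (univalent_in_D h -> sense_preserving (disk (sqrt 7 - 2)) u).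
Proof.
  intros _ D1 D2 _ _ u.
  assert (Hh : forall z, disk 1 z -> twice_der h h1 h2 z).
  { intros z Hz; split; apply cderiv_cder; auto. }
  split; [|split].
  - intros Hc; apply (sense_preserving_of_Re h h1 h2 Hh); intros z Hz.
    destruct (Hc z Hz); repeat split; [exact Hz|assumption|lra].
  - intros alpha Ha Hc; apply (sense_preserving_of_Re h h1 h2 Hh); intros z Hz.
    destruct (Hc z Hz); repeat split; [exact Hz|assumption|lra].
  - intros Hinj; apply (sense_preserving_of_Re h h1 h2 Hh); intros z Hz.
    now apply (univalent_Re_bound h h1 h2 Hh).
Qed.
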